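(* Fix a base $B>1$ and $\delta\in(0,1)$. Let $X_1,\dots,X_N$ be independent, identically distributed random variables whose density $f$ is compactly supported and has a second order Taylor series at each point, with first and second derivatives uniformly bounded. Let $X_{1:N}\le\cdots\le X_{N:N}$ be the $X_i$'s in increasing order, let $F$ be the cumulative distribution function of $f$, and let $I(\epsilon,\delta,N)=[\epsilon N^{1-\delta},\,N^{1-\delta}-\epsilon N^{1-\delta}]$, with $k\in I(\epsilon,\delta,N)$ ranging over integers. Assume that for each fixed $\epsilon\in(0,1/2)$: (i) $f(F^{-1}(kN^{\delta-1}))$ is not too small for $k\in I(\epsilon,\delta,N)$: $$\lim_{N\to\infty}\ \max_{k\in I(\epsilon,\delta,N)}\ \frac{\min\big(N^{-(\epsilon+\delta/2)},\,N^{\delta-1}\big)}{f(F^{-1}(kN^{\delta-1}))}\ =\ 0;$$ (ii) $\log_B f(F^{-1}(kN^{\delta-1}))\bmod 1$ is equidistributed: for all $[\alpha,\beta]\subset[0,1]$, $$\lim_{N\to\infty}\frac{\#\{k\in I(\epsilon,\delta,N):\ \log_B f(F^{-1}(kN^{\delta-1}))\bmod 1\in[\alpha,\beta]\}}{\#\{k\in I(\epsilon,\delta,N)\}}\ =\ \beta-\alpha.$$ Suppose moreover that $\epsilon>\max(0,1/3-\delta/2)$ and $\epsilon<\delta/2$. Define the normalized differences $$\widetilde{Z}_{i:N}\ =\ \frac{X_{i+1:N}-X_{i:N}}{1/(N f(X_{i:N}))},\qquad 1\le i\le N-1.$$ Then, as $N\to\infty$, the distribution of the digits (base $B$) of the $\widetilde{Z}_{i:N}$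 converges to shifted exponential behavior.
   Context: $F^{-1}$ denotes the inverse of $F$, and $x\bmod 1$ is the fractional part of $x$. Every positive real $x$ is written uniquely as $x=M_B(x)B^k$ with $k\in\mathbb{Z}$ and mantissa $M_B(x)\in[1,B)$; the distribution of the digits base $B$ of positive quantities is the distribution of their mantissas, equivalently of their base $B$ logarithms modulo $1$. Let $\zeta$ have the standard exponential distribution (density $e^{-t}$ on $[0,\infty)$). A set exhibits exponential behavior (base $B$) if the distribution of its digits is the same as the distribution of the digits of $\zeta$. It exhibits shifted exponential behavior if there is a constant $C>0$ such that the distribution of digits of all its elements multiplied by $C$ is exponential behavior. *)

(* Defs.v *)
From HB Require Import structures.
From mathcomp Require Export all_boot all_order all_algebra.
From mathcomp Require Export all_classical all_reals all_analysis.

Set Implicit Arguments.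
Unset Strict Implicit.
Unset Printing Implicit Defensive.

Export Order.TTheory GRing.Theory Num.Theory.
Export numFieldNormedType.Exports.

Local Open Scope classical_set_scope.
Local Open Scope ring_scope.

Section Digits.
Context {R : realType}.
Implicit Types (B x a b : R) (s : seq R).

Definition frac_part x : R := x - (Num.floor x)%:~R.

Definition log_base B x : R := ln x / ln B.

(* For x > 0, the unique m in [1, B[ such that x = m * B ^ k with k : int.
   For x <= 0, [ln x = 0], so the value is x itself, outside [1, B[. *)
Definition mantissa B x : R := x / B ^ Num.floor (log_base B x).

(* Elements are counted with multiplicity. *)
Definition digit_freq B s a b : R :=
  (count (fun x => mantissa B x \in `[a, b]) s)%:R / (size s)%:R.

(* The law of the mantissa of a standard exponential random variable. *)
Definition exponential_digit_law B a b : R :=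
  fine (exponential_prob (1 : R) [set x | mantissa B x \in `[a, b]]).

End Digits.

Section Density.
Context {R : realType}.
Implicit Types f : R -> R.

Definition compactly_supported f := compact (closure [set x | f x != 0]).

Definition second_order_taylor_at f (x : R) :=
  [/\ derivable f x 1, derivable (derive1 f) x 1 &
      (f (x + h) - (f x + derive1 f x * h + derive1 (derive1 f) x / 2 * h ^+ 2)) / h ^+ 2
        @[h --> 0^'] --> (0 : R)].

Definition uniformly_bounded (g : R -> R) := exists M : R, forall x, `|g x| <= M.

Definition cdf_of f (x : R) : R :=
  fine (\int[lebesgue_measure]_(y in `]-oo, x]) (f y)%:E).

(* The inverse of [cdf_of f] where the latter is invertible. *)
Definition inv_cdf f (u : R) : R := inf [set x | u <= cdf_of f x].

End Density.

Section Sample.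
Context {R : realType}.

Definition has_density d (T : measurableType d) (P : probability T R)
    (X : {RV P >-> R}) (f : R -> R) :=
  forall A : set R, measurable A ->
    distribution P X A = (\int[lebesgue_measure]_(x in A) (f x)%:E)%E.

(* Taking some of the A i equal to setT gives the product rule for every
   subfamily. *)
Definition mutually_independent d (T : measurableType d) (P : probability T R)
    (n : nat) (X : 'I_n -> {RV P >-> R}) :=
  forall A : 'I_n -> set R, (forall i, measurable (A i)) ->
    P (\bigcap_(i in [set: 'I_n]) (X i @^-1` A i)) =
    (\prod_(i < n) P (X i @^-1` A i))%E.

(* The order statistic X_{i:N}, numbered from i = 1 to i = N. *)
Definition order_stat (N : nat) (x : 'I_N -> R) (i : nat) : R :=
  nth 0 (sort <=%R (codom x)) i.-1.

Definition normalized_difference (f : R -> R) (N : nat) (x : 'I_N -> R)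
    (i : nat) : R :=
  (order_stat x i.+1 - order_stat x i) / (1 / (N%:R * f (order_stat x i))).

Definition normalized_differences (f : R -> R) (N : nat) (x : 'I_N -> R) :
    seq R :=
  [seq normalized_difference f x i | i <- iota 1 N.-1].

(* The digit distributions of the random finite collections [Z N] converge, in
   probability, to the exponential one, after multiplication by some constant
   which depends neither on N nor on the outcome. *)
Definition converges_to_shifted_exponential_behavior (B : R)
    (d : nat -> measure_display) (T : forall N, measurableType (d N))
    (P : forall N, probability (T N) R) (Z : forall N, T N -> seq R) :=
  exists2 C : R, 0 < C &
    forall a b : R, 1 <= a -> a <= b -> b <= B ->
    forall eta : R, 0 < eta ->
      P N [set w | eta < `|digit_freq B [seq C * z | z <- Z N w] a b
                           - exponential_digit_law B a b|]
        @[N --> \oo] --> 0%E.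

End Sample.

Section Conditions.
Context {R : realType}.
Implicit Types (f : R -> R) (B eps delta : R).

(* The integers in I(eps, delta, N).  For eps > 0 and 0 < delta < 1 they are
   nonnegative and, as N ^ (1 - delta) <= N for N >= 1, at most N. *)
Definition index_range eps delta (N : nat) : seq nat :=
  [seq k <- iota 0 N.+1 |
    (k%:R : R) \in `[eps * N%:R `^ (1 - delta),
                     N%:R `^ (1 - delta) - eps * N%:R `^ (1 - delta)]].

Definition density_at_quantile f delta (N k : nat) : R :=
  f (inv_cdf f (k%:R * N%:R `^ (delta - 1))).

(* Since x / 0 = 0 here, the positivity of the denominators, implicit in the
   existence of a finite limit of the maxima, is required explicitly. *)
Definition density_not_too_small f delta eps :=
  (\forall N \near \oo, forall k, k \in index_range eps delta N ->
     0 < density_at_quantile f delta N k) /\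
  (\big[Num.max/0]_(k <- index_range eps delta N)
      (Num.min (N%:R `^ (- (eps + delta / 2))) (N%:R `^ (delta - 1)) /
       density_at_quantile f delta N k))
    @[N --> \oo] --> (0 : R).

Definition log_density_equidistributed f B delta eps :=
  forall alpha beta : R, 0 <= alpha -> alpha <= beta -> beta <= 1 ->
    (count (fun k => frac_part (log_base B (density_at_quantile f delta N k))
                       \in `[alpha, beta]) (index_range eps delta N))%:R /
    (size (index_range eps delta N))%:R
    @[N --> \oo] --> (beta - alpha : R).

End Conditions.

(* Main.v *)
(* Conditionally on X_j = x, the distance to the next sample point to the right
   of x exceeds t / (N f(x)) with probability about (1 - t / N) ^ N, and for two
   distant sample points these events are asymptotically independent.  So, by a
   second moment argument, the proportion of the normalized differences exceeding
   t tends to e^-t in probability, for every t > 0.  The set of the numbers with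
   mantissa in [a, b] and its complement contain finite unions of intervals which
   together carry almost all of the exponential law, so finitely many values of t
   control the digits.  The shift constant is C = 1. *)

Require Import Defs.
From mathcomp Require Import all_boot all_order all_algebra.
From mathcomp Require Import all_classical all_reals all_analysis.
From mathcomp Require Import perm measurable_realfun ring lra.

Set Implicit Arguments.
Unset Strict Implicit.
Unset Printing Implicit Defensive.

Local Open Scope classical_set_scope.
Local Open Scope ring_scope.

(** * Linear combinations of indicators *)

(** Two obstacles shape the proof. Independence is available only as a product rule over rectangles,
    so conditioning on the exact value of a sample point is replaced by locating it in a narrow cell
    of a grid; there the interval that must be empty becomes a deterministic one, slightly too long
    for lower bounds and slightly too short for upper bounds. Moreover the scale [t / (N f(x))]
    degenerates where the density is small, so cells with [f] below a threshold [kappa] are set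
    aside, at a cost of order [kappa].

    One-sided information suffices for the second moment argument. When [(V / N - e) ^ 2] is
    expanded, with [V] the number of large gaps out of [N] and [e] the limit proportion, only a
    lower bound for the mean of [V] and an upper bound for the mean of [V ^ 2] are needed. The first
    comes from strict isolation, the second from pairs of weakly isolated points, and the two
    notions never have to be compared. *)

Section IndicatorCombinations.
Context {R : realType} d (T : measurableType d) (P : probability T R).

Lemma integrable_indicator_combination (s : seq (R * set T)) :
  (forall p, p \in s -> measurable p.2) ->
  P.-integrable setT (fun w => (\sum_(p <- s) p.1 * \1_(p.2) w)%:E) /\
  (\int[P]_w (\sum_(p <- s) p.1 * \1_(p.2) w)%:E =
     (\sum_(p <- s) p.1 * fine (P p.2))%:E)%E.
Proof.
elim: s => [_|p s IH mA].
  split.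
    under eq_fun do rewrite big_nil.
    exact: integrable0.
  under eq_integral do rewrite big_nil.
  by rewrite integral0 big_nil.
have [|Is Es] := IH; first by move=> q qs; apply: mA; rewrite inE qs orbT.
have mp : measurable p.2 by apply: mA; rewrite inE eqxx.
have Ip : P.-integrable setT (fun w => (\1_(p.2) w)%:E).
  by apply: integrable_indic => //; rewrite fin_num_measure.
have Ipc : P.-integrable setT (fun w => (p.1 * \1_(p.2) w)%:E).
  by under eq_fun do rewrite EFinM; exact: integrableZl.
split.
  under eq_fun do rewrite big_cons EFinD.
  exact: integrableD.
under eq_integral do rewrite big_cons EFinD.
rewrite integralD// Es big_cons EFinD; congr (_ + _)%E.
under eq_integral do rewrite EFinM.
by rewrite integralZl// integral_indic// setIT EFinM fineK// fin_num_measure.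
Qed.

(** Disjoint sums, union bounds and Chebyshev's inequality are all derived below from this
    principle: the weighted events are chosen so that the pointwise inequality is a finite case
    check. *)
Lemma probability_combination_ge0 (s : seq (R * set T)) :
  (forall p, p \in s -> measurable p.2) ->
  (forall w, 0 <= \sum_(p <- s) p.1 * \1_(p.2) w) ->
  0 <= \sum_(p <- s) p.1 * fine (P p.2).
Proof.
move=> mA s_ge0; rewrite -lee_fin -(integrable_indicator_combination mA).2.
by apply: integral_ge0 => w _; rewrite lee_fin.
Qed.

End IndicatorCombinations.

(** * Order statistics and isolated sample points *)

Section Gaps.
Context {R : realType}.
Implicit Types (f : R -> R) (t : R).

(** Multiplied out, so that no division occurs where [f] vanishes; there no gap is large when
    [t >= 0]. *)
Definition gap_after f N t (x : 'I_N -> R) (j l : 'I_N) : bool :=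
  t < N%:R * f (x j) * (x l - x j).

(* A repeated sample value is never strictly isolated but may be weakly
   isolated; the number of large gaps lies between the two counts. *)
Definition strictly_isolated f N t (x : 'I_N -> R) (j : 'I_N) : bool :=
  [forall l, (l != j) ==> ((x l < x j) || gap_after f t x j l)].

Definition weakly_isolated f N t (x : 'I_N -> R) (j : 'I_N) : bool :=
  [forall l, (x l <= x j) || gap_after f t x j l].

(** Realizing the sort by a permutation of the indices breaks ties consistently: each rank belongs
    to one sample point, so gaps can be counted by their left ends. *)
Lemma order_stat_perm N (x : 'I_N -> R) :
  exists2 s : {perm 'I_N}, (forall i : 'I_N, order_stat x i.+1 = x (s i)) &
    (forall i j : 'I_N, (i <= j)%N -> x (s i) <= x (s j)).
Proof.
pose u := [tuple x i | i < N].
have uE : codom x = u by rewrite /codom /image_mem /u /= enumT.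
have /tuple_permP[s sE] : perm_eq (sort <=%R (codom x)) u.
  by rewrite perm_sort uE.
have nthE (i : 'I_N) : nth 0 (sort <=%R (codom x)) i = x (s i).
  rewrite sE (nth_map i) ?size_enum_ord // nth_ord_enum.
  by rewrite tnth_mktuple.
exists s => [i|i j ij]; first exact: nthE.
rewrite -!nthE; apply: (sorted_leq_nth le_trans lexx) => //.
- exact: sort_le_sorted.
- by rewrite inE sE size_tuple.
- by rewrite inE sE size_tuple.
Qed.

(** Valid also where [f] vanishes: with the convention [0^-1 = 0] both sides are then 0. *)
Lemma normalized_differenceE f N (x : 'I_N -> R) i :
  normalized_difference f x i =
  N%:R * f (order_stat x i) * (order_stat x i.+1 - order_stat x i).
Proof. by rewrite /normalized_difference div1r invrK mulrC. Qed.

Lemma count_normalized_differences f n (x : 'I_n.+1 -> R) (a : pred R) :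
  count a (normalized_differences f x) =
  #|[pred i : 'I_n | a (normalized_difference f x i.+1)]|.
Proof.
rewrite /normalized_differences /= count_map cardE size_filter.
rewrite -[1%N]/(1 + 0)%N iotaDl -val_enum_ord -map_comp count_map.
by rewrite -enumT; apply: eq_count => i.
Qed.

(** The left end of a large gap is weakly isolated: points of lower rank are not to its right, and
    points of higher rank lie beyond the gap. *)
Lemma count_le_weakly_isolated f n t (x : 'I_n.+1 -> R) :
  (forall y, 0 <= f y) -> 0 <= t ->
  (count (> t)%R (normalized_differences f x) <=
    #|[pred j | weakly_isolated f t x j]|)%N.
Proof.
move=> f_ge0 t_ge0; have [s sE s_le] := order_stat_perm x.
rewrite count_normalized_differences.
have inj : injective (fun i : 'I_n => s (widen_ord (leqnSn n) i)).
  by move=> i j /perm_inj/(congr1 val)/= /val_inj.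
rewrite -(fintype.card_image inj); apply/subset_leq_card/fintype.subsetP => j.
move=> /fintype.imageP[i]; rewrite !inE normalized_differenceE.
rewrite (sE (widen_ord (leqnSn n) i)) (sE (lift ord0 i)) => large ->.
apply/forallP => l; rewrite -(permKV s l).
have [le_li|lt_il] := leqP (s^-1%g l) i; first by rewrite s_le.
apply/orP; right; apply: (lt_le_trans large).
by rewrite ler_wpM2l ?mulr_ge0// lerB// s_le.
Qed.

(** The extra 1 accounts for the point of highest rank, which may be isolated but has no gap after
    it. Any other strictly isolated point is separated from the point of next rank, which is not
    below it, and this separation is its gap. *)
Lemma strictly_isolated_le_count f n t (x : 'I_n.+1 -> R) :
  (forall y, 0 <= f y) ->
  (#|[pred j | strictly_isolated f t x j]| <=
    (count (> t)%R (normalized_differences f x)).+1)%N.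
Proof.
move=> f_ge0; have [s sE s_le] := order_stat_perm x.
rewrite count_normalized_differences.
have inj : injective (fun i : 'I_n => s (widen_ord (leqnSn n) i)).
  by move=> i j /perm_inj/(congr1 val)/= /val_inj.
rewrite -(fintype.card_image inj) (cardD1 (s ord_max)).
rewrite -[X in (_ <= X)%N]add1n leq_add ?leq_b1//.
apply/subset_leq_card/fintype.subsetP => j; rewrite !inE => /andP[j_max j_iso].
pose k := s^-1%g j; have sk : s k = j by rewrite permKV.
have lt_kn : (k < n)%N.
  rewrite ltn_neqAle -ltnS ltn_ord andbT; apply: contra j_max => /eqP k_n.
  by rewrite -sk; apply/eqP; congr (s _); apply: val_inj.
apply/fintype.imageP; exists (Ordinal lt_kn); last first.
  by rewrite -[LHS]sk; congr (s _); apply: val_inj.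
rewrite inE normalized_differenceE.
rewrite (sE (widen_ord (leqnSn n) (Ordinal lt_kn))).
rewrite (sE (lift ord0 (Ordinal lt_kn))).
have kE : widen_ord (leqnSn n) (Ordinal lt_kn) = k by apply: val_inj.
set k1 := lift _ _; rewrite kE.
have k1_k : s k1 != j.
  rewrite -sk (inj_eq perm_inj) -val_eqE /= /bump /=.
  by rewrite add1n gtn_eqF.
have := forallP j_iso (s k1); rewrite k1_k /= /gap_after sk.
by rewrite -{1}sk ltNge s_le //= /bump /= add1n leqnSn.
Qed.

End Gaps.

Section Measurability.
Context {R : realType} d (T : measurableType d).

Lemma measurable_count (I : Type) (s : seq I) (b : I -> T -> bool) :
  (forall i, measurable [set w | b i w]) ->
  measurable_fun setT (fun w => (count (b^~ w) s)%:R : R).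
Proof.
move=> mb; elim: s => [|i s IH] /=; first exact: measurable_cst.
rewrite (_ : (fun w => _) =
  (fun w => \1_[set w | b i w] w + (count (b^~ w) s)%:R)); last first.
  apply/funext => w; rewrite natrD indicE; congr (_%:R + _).
  by congr nat_of_bool; apply/idP/idP; rewrite inE.
by apply: measurable_funD => //; exact: measurable_indic.
Qed.

(** The value in position [i.-1] of the sorted list is at least [t] exactly when at most [i.-1]
    sample values are below [t]; this turns sorting into counting measurable events. Past the end of
    the list the value is the constant default 0. *)
Lemma measurable_order_stat N (X : 'I_N -> T -> R) i :
  (forall j, measurable_fun setT (X j)) ->
  measurable_fun setT (fun w => order_stat (X^~ w) i).
Proof.
move=> mX; have [lt_iN|le_Ni] := ltnP i.-1 N; last first.
  rewrite (_ : (fun w => _) = cst 0) // funeqE => w.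
  by rewrite /order_stat nth_default // size_sort size_codom card_ord.
apply: (measurability _ (RGenCInfty.measurableE R)) => //= _ [_ [t ->] <-].
rewrite setTI (_ : _ @^-1` _ =
  [set w | (count (fun j => X j w < t) (enum 'I_N))%:R <= i.-1%:R :> R]).
  rewrite -[X in measurable X]setTI.
  have mlt j : measurable [set w | X j w < t].
    rewrite -[X in measurable X]setTI.
    exact: (measurable_fun_ltr (mX j) (@measurable_cst _ _ _ _ _ t) measurableT
      (Y := [set true]) I).
  exact: (measurable_fun_ler (measurable_count _ mlt)
    (@measurable_cst _ _ _ _ _ _) measurableT (Y := [set true]) I).
have sorted_s w : sorted <=%R (sort <=%R (codom (X^~ w))).
  exact: sort_le_sorted.
have countE w : count (fun j => X j w < t) (enum 'I_N) =
    count (< t)%R (sort <=%R (codom (X^~ w))).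
  rewrite (seq.permP (permEl (perm_sort _ _))) [in RHS]count_map.
  exact: eq_count.
apply/seteqP; split => w; rewrite /= in_itv /= andbT /order_stat ler_nat countE.
  move=> t_le; rewrite leqNgt; apply/negP => /(nth_count_lt 0 (sorted_s w)).
  by rewrite ltNge t_le.
move=> le_i; apply: (nth_count_ge _ (sorted_s w)).
by rewrite le_i size_sort size_codom card_ord.
Qed.

End Measurability.

(** * Mantissas *)

Section Mantissa.
Context {R : realType} (B : R).
Hypothesis B_gt1 : 1 < B.

Let B_gt0 : 0 < B. Proof. exact: lt_trans ltr01 B_gt1. Qed.

Lemma ln_exprz (k : int) : ln (B ^ k) = k%:~R * ln B.
Proof.
case: k => n; first by rewrite -exprnP lnXn // mulr_natl.
by rewrite NegzE -exprnN lnV ?posrE ?exprn_gt0// lnXn// mulrNz mulNr mulr_natl.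
Qed.

Lemma floor_log_base x (k : int) : 0 < x ->
  (Num.floor (log_base B x) == k) = (B ^ k <= x < B ^ (k + 1)).
Proof.
move=> x_gt0; rewrite floor_eq /log_base ler_pdivlMr ?ln_gt0// ltr_pdivrMr ?ln_gt0//.
by rewrite -!ln_exprz ler_ln ?ltr_ln ?posrE// exprz_gt0.
Qed.

Lemma mantissa_nonpos x : x <= 0 -> mantissa B x = x.
Proof.
by move=> x_le0; rewrite /mantissa /log_base ln0// mul0r floor0 expr0z divr1.
Qed.

(** The clause [x < B ^ (k + 1)] matters once [b] reaches [B]: the point [B ^ (k + 1)] has mantissa
    1, not [B]. Nonpositive [x] fail both sides because [a >= 1]. *)
Lemma mantissa_itvP a b x : 1 <= a ->
  mantissa B x \in `[a, b] <->
  exists k : int, [/\ a * B ^ k <= x, x <= b * B ^ k & x < B ^ (k + 1)].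
Proof.
move=> a_ge1; rewrite in_itv /=; have [x_le0|x_gt0] := lerP x 0.
  rewrite mantissa_nonpos//; split.
    by move=> /andP[/(le_trans a_ge1)/(lt_le_trans ltr01)]; rewrite ltNge x_le0.
  move=> [k [+ _ _]] => /le_trans/(_ x_le0); rewrite leNgt mulr_gt0 ?exprz_gt0//.
  exact: lt_le_trans ltr01 a_ge1.
split=> [|[k [le_x x_le x_lt]]].
  rewrite /mantissa; have := floor_log_base (Num.floor (log_base B x)) x_gt0.
  rewrite eqxx => /esym/andP[_ x_lt].
  rewrite ler_pdivlMr ?exprz_gt0// ler_pdivrMr ?exprz_gt0// => /andP[? ?].
  by eexists; split; eassumption.
have /eqP fl : Num.floor (log_base B x) == k.
  by rewrite floor_log_base// x_lt andbT (le_trans _ le_x)// ler_peMl// exprz_ge0 ?ltW.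
by rewrite /mantissa fl ler_pdivlMr ?exprz_gt0// ler_pdivrMr ?exprz_gt0// le_x.
Qed.

Lemma measurable_digit_set a b : 1 <= a ->
  measurable [set x | mantissa B x \in `[a, b]].
Proof.
move=> a_ge1.
rewrite (_ : [set x | _] = \bigcup_(k in [set: int])
  (`[a * B ^ k, b * B ^ k] `&` `]-oo, B ^ (k + 1)[)); last first.
  apply/seteqP; split => x /=.
    move=> /(mantissa_itvP _ _ a_ge1)[k [? ? ?]]; exists k => //=.
    by rewrite !in_itv /=; split => //; apply/andP.
  move=> [k _] /=; rewrite !in_itv /= => -[/andP[? ?] ?].
  by apply/(mantissa_itvP _ _ a_ge1); exists k.
apply: countable_bigcupT_measurable => [|k]; first exact: countableP.
exact: measurableI.
Qed.

End Mantissa.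

(** * Digit sets and their complements approximated from inside by intervals *)

Section Sandwich.
Context {R : realType}.

Lemma sum_disjoint_le (I : finType) (Q : pred I) (b : bool) :
  (forall i j, Q i -> Q j -> i = j) -> (forall i, Q i -> b) ->
  \sum_i (Q i)%:R <= b%:R :> R.
Proof.
move=> Q_inj Qb; have [i Qi|Q0] := pickP Q; last first.
  by rewrite big1 ?ler0n// => i _; rewrite Q0.
rewrite (bigD1 i)//= Qi (Qb i Qi) big1 ?addr0// => j ji.
by have [Qj|//] := boolP (Q j); rewrite (Q_inj _ _ Qj Qi) eqxx in ji.
Qed.

(** An equality when [s <= t]. Otherwise the left side can be -1, which happens below when the
    factor [theta] pushes the right end of an interval under its left end. *)
Lemma ltr_indicatorB_le (s t z : R) :
  (s < z)%R%:R - (t < z)%R%:R <= ((s < z) && (z <= t))%R%:R :> R.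
Proof.
by rewrite (ltNge t z); case: (s < z); case: (z <= t);
  rewrite /= ?subrr ?subr0 ?sub0r ?oppr_le0 ?ler0n.
Qed.

Variables (B theta : R) (K : nat).
Hypotheses (B_gt1 : 1 < B) (theta_lt1 : theta < 1).

(** Natural indices with an offset: the exponents run upwards from [-K]. A large [K] captures the
    mass near 0, and a large number of terms the mass near infinity. *)
Let pw (i : nat) : R := B ^ (i%:Z - K%:Z).

Let pw_gt0 i : 0 < pw i.
Proof. by rewrite exprz_gt0// (lt_trans ltr01). Qed.

Let pwS i : pw i.+1 = B ^ (i%:Z - K%:Z + 1).
Proof. by rewrite /pw -addn1 PoszD addrAC. Qed.

Let pwSM i : pw i.+1 = B * pw i.
Proof.
by rewrite pwS expfzDr ?expr1z 1?mulrC// gt_eqF// (lt_trans ltr01).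
Qed.

Let pw_inj x i j : 0 < x -> pw i <= x < pw i.+1 -> pw j <= x < pw j.+1 -> i = j.
Proof.
move=> x_gt0; rewrite !pwS -!floor_log_base// => /eqP -> /eqP/addIr.
by case.
Qed.

(* With [g t] the indicator of [t < z], this is the indicator at [z] of a union
   of intervals ]a B^k, theta b B^k]; the factor [theta < 1] makes up for using
   only the half-lines {t < z}. *)
Definition lower_sum (g : R -> R) (a b : R) n : R :=
  \sum_(i < n) (g (a * B ^ (i%:Z - K%:Z)) - g (theta * b * B ^ (i%:Z - K%:Z))).

(** Since [theta < 1], the bound [z <= theta * b * pw i] becomes the strict
    [z < b * pw i <= pw i.+1], so that even for [b = B] each interval stays within one scale. *)
Lemma lower_sum_le_digit a b n z : 1 <= a -> a <= b -> b <= B ->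
  lower_sum (fun t => (t < z)%R%:R) a b n <= (mantissa B z \in `[a, b])%:R.
Proof.
move=> a_ge1 ab bB.
have b_gt0 : 0 < b.
  by apply: lt_le_trans ab; apply: lt_le_trans a_ge1.
apply: (@le_trans _ _
  (\sum_(i < n) ((a * pw i < z) && (z <= theta * b * pw i))%R%:R)).
  by apply: ler_sum => i _; exact: ltr_indicatorB_le.
have Q_in i : (a * pw i < z) && (z <= theta * b * pw i) ->
    [/\ a * pw i <= z, z <= b * pw i & z < pw i.+1].
  move=> /andP[az zb]; have zb' : z < b * pw i.
    by rewrite (le_lt_trans zb)// ltr_pM2r// gtr_pMl.
  by split; rewrite ?ltW// (lt_le_trans zb')// pwSM ler_wpM2r// ltW.
apply: sum_disjoint_le => [i j /Q_in[ai _ ui] /Q_in[aj _ uj]|i].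
  have le_a k : pw k <= a * pw k by rewrite ler_peMl// ltW.
  apply/val_inj/(@pw_inj z) => /=.
  - by rewrite (lt_le_trans _ ai)// mulr_gt0// (lt_le_trans ltr01).
  - by rewrite ui (le_trans _ ai).
  - by rewrite uj (le_trans _ aj).
by move=> /Q_in[ai bi ui]; apply/(mantissa_itvP _ _ _ a_ge1) => //;
  exists (i%:Z - K%:Z); rewrite -pwS.
Qed.

(** The counterpart for the complement: the intervals ]b B^k, theta a B^(k+1)] lie between
    consecutive blocks of the digit set. The name refers to the upper bound [1 - upper_sum] for the
    digit set. *)
Definition upper_sum (g : R -> R) (a b : R) n : R :=
  \sum_(i < n) (g (b * B ^ (i%:Z - K%:Z)) - g (theta * a * B ^ (i.+1%:Z - K%:Z))).

Lemma digit_le_upper_sum a b n z : 1 <= a -> a <= b -> b <= B ->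
  (mantissa B z \in `[a, b])%:R <= 1 - upper_sum (fun t => (t < z)%R%:R) a b n.
Proof.
move=> a_ge1 ab bB; have a_gt0 : 0 < a by exact: lt_le_trans a_ge1.
have b_gt0 : 0 < b by exact: lt_le_trans ab.
rewrite lerBrDr -lerBrDl; set c := _ \in _.
apply: (@le_trans _ _
  (\sum_(i < n) ((b * pw i < z) && (z <= theta * a * pw i.+1))%R%:R)).
  by apply: ler_sum => i _; exact: ltr_indicatorB_le.
rewrite (_ : 1 - _ = (~~ c)%:R); last by case: c; rewrite /= ?subrr ?subr0.
have Q_in i : (b * pw i < z) && (z <= theta * a * pw i.+1) ->
    b * pw i < z /\ z < a * pw i.+1.
  move=> /andP[bz za]; split=> //.
  by rewrite (le_lt_trans za)// ltr_pM2r// gtr_pMl.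
apply: sum_disjoint_le => [i j /Q_in[bi ai] /Q_in[bj aj]|i /Q_in[bi ai]].
  have z_gt0 : 0 < z by rewrite (lt_trans _ bi)// mulr_gt0.
  (* As [a <= b], dividing by [b] places [z] in a single scale interval, which makes the
     complementary intervals disjoint. *)
  have Q_div k : b * pw k < z -> z < a * pw k.+1 -> pw k <= z / b < pw k.+1.
    move=> bk ak; rewrite ler_pdivlMr// ltr_pdivrMr// mulrC ltW//=.
    by rewrite (lt_le_trans ak)// mulrC ler_wpM2l// ltW.
  by apply/val_inj/(@pw_inj (z / b)); rewrite ?divr_gt0//; exact: Q_div.
(* Membership in the digit set would give an integer exponent strictly between [i - K] and
   [i - K + 1]. *)
apply/negP => /(mantissa_itvP B_gt1 _ _ a_ge1)[k [ak bk _]].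
have lt_k : i%:Z - K%:Z < k.
  rewrite -(ltr_eXz2l B_gt1) -(ltr_pM2l b_gt0).
  exact: lt_le_trans bi bk.
have := le_lt_trans ak ai.
rewrite ltr_pM2l// pwS (ltr_eXz2l B_gt1) ltNge => /negP; apply.
by rewrite lezD1.
Qed.

End Sandwich.

(** * From tail frequencies to digit frequencies *)

Section DigitApproximation.
Context {R : realType}.

Lemma exponential_tail (t : R) : 0 < t ->
  fine (exponential_prob (1 : R) [set z | t < z]) = expR (- t).
Proof.
move=> t_gt0.
(* The probability structure depends on a proof that the rate is positive, hence the explicit
   instance. *)
pose P : probability (measurableTypeR R) R :=
  exponential_distribution_exponential_prob__canonical__probability_measure_Probability
    (@ltr01 R).
have P0 : P `]-oo, 0[%classic = 0%E.
  apply: integral0_eq => x /=; rewrite in_itv /= => x_lt0.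
  by rewrite lt0_exponential_pdf.
have -> : [set z | t < z] = ~` (`]-oo, 0[%classic `|` `[0, t]%classic).
  apply/seteqP; split => z /=; rewrite !in_itv /=.
    by move=> tz []; [rewrite ltNge ltW ?(lt_trans t_gt0)|rewrite (leNgt z) tz andbF].
  move=> nz; rewrite ltNge; apply/negP => zt; apply: nz.
  by have [z_lt0|z_ge0] := ltrP z 0; [left|right; rewrite zt].
have -> : exponential_prob (1 : R) = P by [].
rewrite probability_setC; last exact: measurableU.
have PU : P (`]-oo, 0[%classic `|` `[0, t]%classic) =
    (P `]-oo, 0%R[%classic + P `[0%R, t]%classic)%E.
  rewrite measureU//; apply/seteqP; split => // z /=; rewrite !in_itv /=.
  by move=> -[z_lt0 /andP[]]; rewrite leNgt z_lt0.
have PI : P `[0, t]%classic = (1 - (expR (- t))%:E)%E.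
  by have := exponential_prob_itv0c 1 t_gt0; rewrite mulN1r.
rewrite PU P0 add0e PI -!EFinB.
by rewrite /= subKr.
Qed.

(** The sandwich is pointwise in [z]. Here it is integrated against a law, and in [tail_freq_sum_le]
    against the empirical distribution of a finite sequence. *)
Lemma probability_tail_sum_le (P : probability (measurableTypeR R) R) n (s t : 'I_n -> R)
    (A : set R) : measurable A ->
  (forall z, \sum_i ((s i < z)%R%:R - (t i < z)%R%:R) <= \1_A z :> R) ->
  \sum_i (fine (P [set z | s i < z]) - fine (P [set z | t i < z])) <= fine (P A).
Proof.
move=> mA le_A.
have mtail (u : R) : measurable [set z | u < z].
  by rewrite -[X in measurable X]/[set z | _] -set_itvoy; exact: measurable_itv.
pose l := (1, A) :: [seq (-1, [set z | s i < z]) | i <- index_enum 'I_n] ++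
  [seq (1, [set z | t i < z]) | i <- index_enum 'I_n] : seq (R * set R).
have sumE (F : set R -> R) : \sum_(p <- l) p.1 * F p.2 =
    F A - \sum_i (F [set z | s i < z] - F [set z | t i < z]).
  rewrite /l big_cons big_cat !big_map /= mul1r -big_split /= -sumrN.
  by congr (_ + _); apply: eq_bigr => i _; rewrite mulN1r mul1r opprB addrC.
rewrite -subr_ge0 -(sumE (fun S => fine (P S))).
apply: (@probability_combination_ge0 _ _ _ P) => [p|z].
  rewrite inE => /orP[/eqP->//|]; rewrite mem_cat => /orP[]/mapP[i _ ->];
    exact: mtail.
rewrite (sumE (fun S => \1_S z)) subr_ge0; apply: le_trans (le_A z).
have indE (u : R) : \1_[set y | u < y] z = (u < z)%R%:R :> R.
  by rewrite indicE; congr (nat_of_bool _)%:R; apply/idP/idP; rewrite inE.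
by apply: ler_sum => i _; rewrite !indE.
Qed.

Definition tail_freq (s : seq R) (t : R) : R :=
  (count (> t)%R s)%:R / (size s)%:R.

Lemma tail_freq_sum_le (s : seq R) n (u v : 'I_n -> R) (A : pred R) :
  (forall z, \sum_i ((u i < z)%R%:R - (v i < z)%R%:R) <= (A z)%:R :> R) ->
  \sum_i (tail_freq s (u i) - tail_freq s (v i)) <= (count A s)%:R / (size s)%:R.
Proof.
move=> le_A; rewrite /tail_freq.
under eq_bigr do rewrite -mulrBl.
rewrite -mulr_suml ler_wpM2r ?invr_ge0 ?ler0n//.
have countE (a : pred R) : (count a s)%:R = \sum_(z <- s) (a z)%:R :> R.
  by rewrite -sum1_count big_mkcond natr_sum; apply: eq_bigr => z _; case: (a z).
rewrite [leRHS]countE.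
under eq_bigr do rewrite !countE -sumrB.
by rewrite exchange_big /=; apply: ler_sum => z _; exact: le_A.
Qed.

End DigitApproximation.

Section DigitLaw.
Context {R : realType} (B : R).
Hypothesis B_gt1 : 1 < B.

Let B_gt0 : 0 < B. Proof. exact: lt_trans ltr01 B_gt1. Qed.

Lemma exprn_unbounded (M : R) : exists n, M <= B ^+ n.
Proof.
have lnB : 0 < ln B by rewrite ln_gt0.
have [n Mn] : exists n, M / ln B < n%:R.
  by exists (Num.truncn (`|M / ln B|)).+1; apply: le_lt_trans (ler_norm _) _;
     rewrite truncnS_gt.
exists n; rewrite -[B ^+ n]lnK ?posrE ?exprn_gt0// lnXn// -mulr_natl.
move: Mn; rewrite ltr_pdivrMr// => /ltW/le_trans; apply.
by apply: le_trans (expR_ge1Dx _); rewrite lerDr.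
Qed.

Lemma expRN_lt_inv (x : R) : 0 < x -> expR (- x) <= x^-1.
Proof.
move=> x_gt0; rewrite expRN lef_pV2 ?posrE ?expR_gt0//.
by apply: le_trans (expR_ge1Dx _); rewrite lerDr.
Qed.

(** Factor [expR (- x)] as [expR (- (theta * x))] times [expR (- ((1 - theta) * x))], bound the
    latter below by its tangent line, and use that the former is at most 1. *)
Lemma expR_scale_le (theta x : R) : theta <= 1 -> 0 <= theta -> 0 <= x ->
  expR (- (theta * x)) - expR (- x) <= (1 - theta) * x.
Proof.
move=> theta_le1 theta_ge0 x_ge0.
have E : expR (- x) = expR (- (theta * x)) * expR (- ((1 - theta) * x)).
  by rewrite -expRD; congr expR; ring.
have h1 : expR (- (theta * x)) <= 1.
  by rewrite -expR0 ler_expR oppr_le0 mulr_ge0.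
have h2 : 1 - (1 - theta) * x <= expR (- ((1 - theta) * x)).
  exact: expR_ge1Dx.
have h3 : 0 <= (1 - theta) * x by rewrite mulr_ge0 ?subr_ge0.
have := expR_gt0 (- (theta * x)).
rewrite E; nra.
Qed.

(** With [theta] equal to 1 the two sums together would telescope to
    [expR (- (a * y 0)) - expR (- (a * y n))]. Three errors of at most [eta / 3] remain: near 0,
    controlled by [K]; near infinity, controlled by [n]; and the effect of [theta], chosen last
    because it depends on [n]. *)
Lemma sandwich_gap_small (a b eta : R) : 1 <= a -> a <= b -> b <= B -> 0 < eta ->
  exists K n theta, [/\ 0 < theta, theta < 1 &
    1 - eta <= lower_sum B theta K (fun t => expR (- t)) a b n +
               upper_sum B theta K (fun t => expR (- t)) a b n].
Proof.
move=> a_ge1 ab bB eta_gt0.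
have a_gt0 : 0 < a by exact: lt_le_trans a_ge1.
have b_gt0 : 0 < b by exact: lt_le_trans ab.
have [K K_ge] := exprn_unbounded (3 * a / eta).
pose u : R := B ^- K; pose y i := B ^ (i%:Z - K%:Z).
have yE i : y i = u * B ^+ i by rewrite /y /u expfzDr ?gt_eqF// mulrC exprnN.
have BK_gt0 : 0 < B ^+ K by rewrite exprn_gt0.
have u_gt0 : 0 < u by rewrite invr_gt0 exprn_gt0.
have y_gt0 i : 0 < y i by rewrite yE mulr_gt0 ?exprn_gt0.
have au_small : a * u <= eta / 3.
  rewrite /u ler_pdivrMr//; move: K_ge; rewrite ler_pdivrMr//; lra.
have [n n_ge] := exprn_unbounded ((a * u)^-1 * (eta / 3)^-1).
have tail_small : expR (- (a * y n)) <= eta / 3.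
  apply: le_trans (expRN_lt_inv _) _; first by rewrite mulr_gt0.
  rewrite yE mulrA invfM -ler_pdivlMl ?invr_gt0 ?mulr_gt0// invrK.
  rewrite -[leRHS]invrK lef_pV2 ?posrE ?exprn_gt0 ?invr_gt0 ?mulr_gt0 ?invr_gt0
    ?divr_gt0//.
  by rewrite invfM.
pose D := \sum_(i < n) (b * y i + a * y i.+1).
have D_ge0 : 0 <= D by apply: sumr_ge0 => i _; rewrite addr_ge0// mulr_ge0 ?ltW.
(* [D] collects the arguments scaled by [theta], so by [expR_scale_le] the loss is at most
   [(1 - theta) * D]. Adding [1 + eta] keeps the denominator positive and [theta] positive. *)
pose theta := 1 - (eta / 3 / (D + 1 + eta)).
have den_gt0 : 0 < D + 1 + eta by lra.
have ratio_gt0 : 0 < eta / 3 / (D + 1 + eta) by rewrite !divr_gt0.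
have ratio_lt1 : eta / 3 / (D + 1 + eta) < 1 by rewrite ltr_pdivrMr//; lra.
have ratio_D : (1 - theta) * D <= eta / 3.
  rewrite /theta opprB addrC subrK mulrAC ler_pdivrMr// ler_pM2l ?divr_gt0//; lra.
have theta_gt0 : 0 < theta by rewrite /theta; lra.
have theta_lt1 : theta < 1 by rewrite /theta; lra.
exists K, n, theta; split => //.
rewrite /lower_sum /upper_sum -big_split /=.
have tele : \sum_(i < n) (expR (- (a * y i)) - expR (- (a * y i.+1))) =
    expR (- (a * y 0)) - expR (- (a * y n)).
  have := telescope_sumr (fun i => expR (- (a * y i))) (leq0n n).
  rewrite big_mkord => teleE; rewrite -[RHS]opprB -teleE -sumrN.
  by apply: eq_bigr => i _; rewrite opprB.
apply: (@le_trans _ _ (\sum_(i < n) (expR (- (a * y i)) - expR (- (a * y i.+1))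
    - (1 - theta) * (b * y i + a * y i.+1)))).
  rewrite sumrB tele -mulr_sumr -/D.
  have := expR_ge1Dx (- (a * y 0)).
  rewrite {1}yE expr0 mulr1; lra.
apply: ler_sum => i _; rewrite -/(y i) -/(y i.+1) -!mulrA.
have := expR_scale_le (ltW theta_lt1) (ltW theta_gt0) (ltW (mulr_gt0 b_gt0 (y_gt0 i))).
have := expR_scale_le (ltW theta_lt1) (ltW theta_gt0) (ltW (mulr_gt0 a_gt0 (y_gt0 i.+1))).
lra.
Qed.

(** The empirical frequency and the exponential law are both squeezed between [lower_sum] and
    [1 - upper_sum], and these sums involve finitely many tails. The width of the squeeze and the
    change of tails cost [eta / 2] each. *)
Lemma digit_freq_approx (a b eta : R) : 1 <= a -> a <= b -> b <= B -> 0 < eta ->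
  exists2 ts : seq R, (forall t, t \in ts -> 0 < t) &
    exists2 eta' : R, 0 < eta' & forall s : seq R, (0 < size s)%N ->
      (forall t, t \in ts -> `|tail_freq s t - expR (- t)| <= eta') ->
      `|digit_freq B s a b - exponential_digit_law B a b| <= eta.
Proof.
move=> a_ge1 ab bB eta_gt0.
have a_gt0 : 0 < a by exact: lt_le_trans a_ge1.
have b_gt0 : 0 < b by exact: lt_le_trans ab.
have eta2 : 0 < eta / 2 by rewrite divr_gt0.
have [K [n [theta [theta_gt0 theta_lt1 gap]]]] :=
  sandwich_gap_small a_ge1 ab bB eta2.
pose y i := B ^ (i%:Z - K%:Z).
have y_gt0 i : 0 < y i by rewrite exprz_gt0.
pose pts (i : nat) := [:: a * y i; theta * b * y i; b * y i; theta * a * y i.+1].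
exists (flatten [seq pts i | i <- iota 0 n]).
  move=> t /flatten_mapP[i _]; rewrite !inE.
  by move=> /or4P[]/eqP->; rewrite ?mulr_gt0.
(* Each sum uses [2 * n] tail values, for a total error below [eta / 2]; [n.+1] avoids a zero
   denominator. *)
exists (eta / 4 / n.+1%:R) => [|s s_gt0 close]; first by rewrite !divr_gt0.
pose E t : R := expR (- t).
have in_pts (i : 'I_n) t : t \in pts i -> `|tail_freq s t - E t| <= eta / 4 / n.+1%:R.
  move=> ti; apply: close; apply/flatten_mapP; exists (i : nat) => //.
  by rewrite mem_iota /= add0n.
have sum_close (u v : 'I_n -> R) : (forall i, u i \in pts i) -> (forall i, v i \in pts i) ->
    \sum_i (E (u i) - E (v i)) - eta / 2 <=
    \sum_i (tail_freq s (u i) - tail_freq s (v i)).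
  move=> u_pts v_pts; rewrite lerBlDr -lerBlDl -sumrB.
  apply: (@le_trans _ _ (\sum_(i < n) (eta / 2 / n.+1%:R))).
    apply: ler_sum => i _.
    have -> : eta / 2 / n.+1%:R = eta / 4 / n.+1%:R + eta / 4 / n.+1%:R.
      by rewrite -!mulrDl; congr (_ / _); lra.
    move: (in_pts _ _ (u_pts i)) (in_pts _ _ (v_pts i)); rewrite !ler_norml.
    move: (eta / 4 / n.+1%:R) (tail_freq s (u i)) (tail_freq s (v i)) (E (u i)) (E (v i)).
    by move=> q x1 x2 e1 e2 /andP[? ?] /andP[? ?]; lra.
  rewrite sumr_const card_ord -[_ *+ n]mulr_natr mulrAC ler_pdivrMr//.
  by rewrite ler_pM2l// ler_nat.
pose A := [set z | mantissa B z \in `[a, b]].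
have mA : measurable A by exact: measurable_digit_set.
pose P : probability (measurableTypeR R) R :=
  exponential_distribution_exponential_prob__canonical__probability_measure_Probability
    (@ltr01 R).
have PA : exponential_digit_law B a b = fine (P A) by [].
have indA z : \1_A z = (mantissa B z \in `[a, b])%:R :> R.
  by rewrite indicE; congr (nat_of_bool _)%:R; apply/idP/idP; rewrite inE.
have tailE t : 0 < t -> fine (P [set z | t < z]) = E t by exact: exponential_tail.
have lower_P : lower_sum B theta K E a b n <= fine (P A).
  have -> : lower_sum B theta K E a b n = \sum_(i < n)
      (fine (P [set z | a * y i < z]) - fine (P [set z | theta * b * y i < z])).
    by apply: eq_bigr => i _; rewrite !tailE ?mulr_gt0.
  apply: probability_tail_sum_le => // z; rewrite indA.
  exact: lower_sum_le_digit.
have upper_P : fine (P A) <= 1 - upper_sum B theta K E a b n.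
  rewrite lerBrDr -lerBrDl.
  have -> : 1 - fine (P A) = fine (P (~` A)).
    by rewrite probability_setC// -[in RHS](@fineK _ (P A)) ?fin_num_measure.
  have -> : upper_sum B theta K E a b n = \sum_(i < n)
      (fine (P [set z | b * y i < z]) - fine (P [set z | theta * a * y i.+1 < z])).
    by apply: eq_bigr => i _; rewrite !tailE ?mulr_gt0.
  apply: probability_tail_sum_le => [|z]; first exact: measurableC.
  rewrite (_ : \1_(~` A) z = 1 - (mantissa B z \in `[a, b])%:R); last first.
    by rewrite -indA !indicE in_setC; case: (z \in A); rewrite ?subrr ?subr0.
  by rewrite lerBrDr -lerBrDl; exact: digit_le_upper_sum.
have lower_s : lower_sum B theta K (tail_freq s) a b n <= digit_freq B s a b.
  apply: tail_freq_sum_le => z; exact: lower_sum_le_digit.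
have upper_s : digit_freq B s a b <= 1 - upper_sum B theta K (tail_freq s) a b n.
  rewrite lerBrDr -lerBrDl.
  have -> : 1 - digit_freq B s a b =
      (count (predC (fun x => mantissa B x \in `[a, b])) s)%:R / (size s)%:R.
    rewrite /digit_freq -[X in X - _](@divff _ (size s)%:R) ?pnatr_eq0 -?lt0n//.
    by rewrite -mulrBl -(count_predC (fun x => mantissa B x \in `[a, b])) natrD addrAC
      subrr add0r.
  apply: tail_freq_sum_le => z /=.
  rewrite (_ : (~~ _)%:R = 1 - (mantissa B z \in `[a, b])%:R); last first.
    by case: (_ \in _); rewrite ?subrr ?subr0.
  by rewrite lerBrDr -lerBrDl; exact: digit_le_upper_sum.
have close_l : lower_sum B theta K E a b n - eta / 2 <=
    lower_sum B theta K (tail_freq s) a b n.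
  by apply: sum_close => i; rewrite !inE eqxx ?orbT.
have close_u : upper_sum B theta K E a b n - eta / 2 <=
    upper_sum B theta K (tail_freq s) a b n.
  by apply: sum_close => i; rewrite !inE eqxx ?orbT.
have gapE : 1 - eta / 2 <= lower_sum B theta K E a b n + upper_sum B theta K E a b n.
  exact: gap.
rewrite PA ler_norml; move: gapE lower_P upper_P lower_s upper_s close_l close_u.
move: (lower_sum B theta K E a b n) (upper_sum B theta K E a b n)
  (lower_sum B theta K (tail_freq s) a b n) (upper_sum B theta K (tail_freq s) a b n)
  (digit_freq B s a b) (fine (P A)) => *.
apply/andP; split; lra.
Qed.

End DigitLaw.

(** * Isolation probabilities *)

Section IndependentSample.
Context {R : realType} d (T : measurableType d) (P : probability T R).
Variables (N : nat) (X : 'I_N -> {RV P >-> R}).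
Variable rho : probability R R.
Hypothesis X_indep : mutually_independent X.
Hypothesis X_law : forall i A, measurable A -> P (X i @^-1` A) = rho A.

Local Notation r A := (fine (rho A)).

Let rho_fin A : measurable A -> rho A = (r A)%:E.
Proof. by move=> mA; rewrite fineK// fin_num_measure. Qed.

Let rC A : measurable A -> r (~` A) = 1 - r A.
Proof. by move=> mA; rewrite probability_setC// rho_fin. Qed.

Lemma independent_prod (A : 'I_N -> set R) : (forall i, measurable (A i)) ->
  fine (P [set w | forall i, A i (X i w)]) = \prod_i r (A i).
Proof.
move=> mA; have -> : [set w | forall i, A i (X i w)] =
    \bigcap_(i in [set: 'I_N]) (X i @^-1` A i).
  by apply/seteqP; split => w /= wA i; [move=> _|]; exact: wA.
rewrite X_indep//.
rewrite (eq_bigr (fun i => (r (A i))%:E)) => [|i _]; last first.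
  by rewrite -rho_fin// -(X_law i).
by rewrite prodEFin.
Qed.

(* Localizing a sample point in a cell makes its exclusion zone deterministic,
   so that the product rule over rectangles suffices. *)
Lemma one_cell_prob j c J : measurable c -> measurable J ->
  fine (P [set w | c (X j w) /\ forall i, i != j -> ~ J (X i w)]) =
  r c * (1 - r J) ^+ N.-1.
Proof.
move=> mc mJ; pose A i := if i == j then c else ~` J.
have mA i : measurable (A i) by rewrite /A; case: ifP => // _; exact: measurableC.
have -> : [set w | c (X j w) /\ forall i, i != j -> ~ J (X i w)] =
    [set w | forall i, A i (X i w)].
  apply/seteqP; split => w /= => [[cj Ji] i|wA].
    by rewrite /A; case: eqP => [->//|/eqP]; exact: Ji.
  split=> [|i ij]; first by have := wA j; rewrite /A eqxx.
  by have := wA i; rewrite /A (negbTE ij).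
rewrite independent_prod// (bigD1 j)//= {1}/A eqxx; congr (_ * _).
rewrite (eq_bigr (fun=> 1 - r J)) => [|i /negbTE ij]; last by rewrite /A ij rC.
by rewrite prodr_const cardC1 card_ord.
Qed.

(** To be used with [J] the union of two exclusion zones; it constrains only the [N.-2] remaining
    points, hence the exponent. *)
Lemma two_cells_prob j l c c' J : j != l ->
  measurable c -> measurable c' -> measurable J ->
  fine (P [set w | [/\ c (X j w), c' (X l w) &
    forall i, i != j -> i != l -> ~ J (X i w)]]) =
  r c * r c' * (1 - r J) ^+ N.-2.
Proof.
move=> jl mc mc' mJ.
pose A i := if i == j then c else if i == l then c' else ~` J.
have mA i : measurable (A i).
  by rewrite /A; do 2 case: ifP => // _; exact: measurableC.
have -> : [set w | [/\ c (X j w), c' (X l w) &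
      forall i, i != j -> i != l -> ~ J (X i w)]] =
    [set w | forall i, A i (X i w)].
  apply/seteqP; split => w /= => [[cj cl Ji] i|wA].
    rewrite /A; case: eqP => [->//|/eqP ij].
    by case: eqP => [->//|/eqP il]; exact: Ji.
  split=> [||i ij il]; first by have := wA j; rewrite /A eqxx.
    by have := wA l; rewrite /A eq_sym (negbTE jl) eqxx.
  by have := wA i; rewrite /A (negbTE ij) (negbTE il).
rewrite independent_prod// (bigD1 j)//= {1}/A eqxx -mulrA; congr (_ * _).
rewrite (bigD1 l) 1?eq_sym//= {1}/A eq_sym (negbTE jl) eqxx; congr (_ * _).
rewrite (eq_bigr (fun=> 1 - r J)) => [|i /andP[/negbTE ij /negbTE il]]; last first.
  by rewrite /A ij il rC.
rewrite prodr_const; congr (_ ^+ _).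
rewrite -[N in RHS]card_ord [in RHS](cardD1 j) [in RHS](cardD1 l) !inE.
rewrite (eq_sym l) jl !add1n /=.
by apply: eq_card => i; rewrite !inE andbT andbC.
Qed.

Variables (f : R -> R) (t : R).
Hypothesis mf : measurable_fun setT f.

Let mgap j i : measurable [set w | gap_after f t (X^~ w) j i].
Proof.
rewrite -[X in measurable X]setTI /gap_after.
apply: (@measurable_fun_ltr _ _ _ setT (cst t)
  (fun w => N%:R * f (X j w) * (X i w - X j w)) _ _ measurableT [set true] I) => //.
apply: measurable_funM; last exact: measurable_funB.
by apply: measurable_funM => //; exact: measurableT_comp.
Qed.

Lemma measurable_strictly_isolated j :
  measurable [set w | strictly_isolated f t (X^~ w) j].
Proof.
rewrite (_ : [set w | _] = \bigcap_(i in [set i | i != j])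
  ([set w | X i w < X j w] `|` [set w | gap_after f t (X^~ w) j i])).
  apply: fin_bigcap_measurable => [|i _]; first exact: finite_finset.
  apply: measurableU => //.
  rewrite -[X in measurable X]setTI.
  exact: (@measurable_fun_ltr _ _ _ setT (X i) (X j) _ _ measurableT [set true] I).
apply/seteqP; split => w /=.
  by move=> /forallP iso i /= ij; have := iso i; rewrite ij => /orP[]; [left|right].
move=> iso; apply/forallP => i; apply/implyP => ij; apply/orP.
by have [] := iso i ij; [left|right].
Qed.

Lemma measurable_weakly_isolated j :
  measurable [set w | weakly_isolated f t (X^~ w) j].
Proof.
rewrite (_ : [set w | _] = \bigcap_(i in [set: 'I_N])
  ([set w | X i w <= X j w] `|` [set w | gap_after f t (X^~ w) j i])).
  apply: fin_bigcap_measurable => [|i _]; first exact: finite_finset.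
  apply: measurableU => //.
  rewrite -[X in measurable X]setTI.
  exact: (@measurable_fun_ler _ _ _ setT (X i) (X j) _ _ measurableT [set true] I).
apply/seteqP; split => w /=.
  by move=> /forallP iso i /= _; have := iso i => /orP[]; [left|right].
by move=> iso; apply/forallP => i; apply/orP; have [] := iso i I; [left|right].
Qed.

Variables (m : nat) (c J : 'I_m -> set R).
Hypotheses (mc : forall k, measurable (c k)) (mJ : forall k, measurable (J k)).
Hypothesis c_disj : forall k k' x, c k x -> c k' x -> k = k'.

(** The events that [X j] lies in a good cell [c k] while no other point lies in [J k] are disjoint
    and imply isolation. Discarding the other cells only lowers the sum. *)
Lemma strictly_isolated_prob_ge (good : pred 'I_m) q j : q <= 1 ->
  (forall k, good k -> r (J k) <= q) ->
  (forall k x y, good k -> c k x -> ~ J k y ->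
    (y < x) || (t < N%:R * f x * (y - x))) ->
  (\sum_(k | good k) r (c k)) * (1 - q) ^+ N.-1 <=
  fine (P [set w | strictly_isolated f t (X^~ w) j]).
Proof.
move=> q_le1 Jq J_gap.
pose S := [set w | strictly_isolated f t (X^~ w) j].
pose E k := [set w | c k (X j w) /\ forall i, i != j -> ~ J k (X i w)].
have mE k : measurable (E k).
  rewrite (_ : E k = (X j @^-1` c k) `&`
    \bigcap_(i in [set i | i != j]) (X i @^-1` (~` J k))) //.
  apply: measurableI; first by rewrite -[X in measurable X]setTI; exact: measurable_funP.
  apply: fin_bigcap_measurable => [|i _]; first exact: finite_finset.
  rewrite -[X in measurable X]setTI.
  by apply: measurable_funP => //; exact: measurableC.
have mS : measurable S by exact: measurable_strictly_isolated.
apply: (@le_trans _ _ (\sum_(k | good k) fine (P (E k)))).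
  rewrite mulr_suml; apply: ler_sum => k gk; rewrite one_cell_prob//.
  rewrite ler_wpM2l ?fine_ge0// lerXn2r ?nnegrE ?subr_ge0//; last by rewrite lerB// Jq.
  by rewrite (le_trans (Jq _ gk)).
pose l := (1, S) :: [seq (-1, E k) | k <- index_enum 'I_m & good k] : seq (R * set T).
have sumE (F : set T -> R) : \sum_(p <- l) p.1 * F p.2 = F S - \sum_(k | good k) F (E k).
  rewrite /l big_cons big_map big_filter /= mul1r -sumrN.
  by congr (_ + _); apply: eq_bigr => k _; rewrite mulN1r.
rewrite -subr_ge0 -(sumE (fun A => fine (P A))).
apply: (@probability_combination_ge0 _ _ _ P) => [p|w].
  by rewrite inE => /orP[/eqP->//|/mapP[k _ ->]]; exact: mE.
rewrite (sumE (fun A => \1_A w)) subr_ge0.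
rewrite [leLHS](_ : _ = \sum_k ((good k) && (w \in E k))%:R); last first.
  by rewrite big_mkcond; apply: eq_bigr => k _; rewrite indicE; case: (good k).
rewrite indicE; apply: sum_disjoint_le => [k k' /andP[_]|k /andP[gk]]; rewrite !inE.
  by move=> [ck _] /andP[_]; rewrite inE => -[ck' _]; exact: c_disj ck ck'.
move=> [ck Jk]; apply/forallP => i; apply/implyP => ij.
exact: J_gap gk ck (Jk i ij).
Qed.

(** If both points are weakly isolated and lie in cells [k] and [k'], no third point can be in [J k]
    or [J k']. The zones need not avoid the pair itself. *)
Lemma weakly_isolated_pair_prob_le j l : j != l ->
  \sum_k r (c k) = 1 ->
  (forall k x y, c k x -> J k y -> x < y /\ N%:R * f x * (y - x) <= t) ->
  fine (P [set w | weakly_isolated f t (X^~ w) j /\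
                   weakly_isolated f t (X^~ w) l]) <=
  \sum_k \sum_k' r (c k) * r (c k') * (1 - r (J k `|` J k')) ^+ N.-2.
Proof.
move=> jl c_full J_near.
pose W := [set w | weakly_isolated f t (X^~ w) j /\ weakly_isolated f t (X^~ w) l].
pose C i k := X i @^-1` c k.
pose E (p : 'I_m * 'I_m) := [set w | [/\ c p.1 (X j w), c p.2 (X l w) &
  forall i, i != j -> i != l -> ~ (J p.1 `|` J p.2) (X i w)]].
have mX i A : measurable A -> measurable (X i @^-1` A).
  by move=> mA; rewrite -[X in measurable X]setTI; exact: measurable_funP.
have mW : measurable W.
  by apply: measurableI; exact: measurable_weakly_isolated.
have mE p : measurable (E p).
  rewrite (_ : E p = (X j @^-1` c p.1) `&` (X l @^-1` c p.2) `&`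
      \bigcap_(i in [set i | i != j /\ i != l]) (X i @^-1` (~` (J p.1 `|` J p.2)))).
    apply: measurableI; first by apply: measurableI; exact: mX.
    apply: fin_bigcap_measurable => [|i _]; first exact: finite_finset.
    apply: mX; apply: measurableC.
    exact: measurableU.
  apply/seteqP; split => w /=.
    by move=> [cj cl Ji]; split=> // i /= [ij il]; exact: Ji.
  by move=> [[cj cl] Ji]; split=> // i ij il; exact: Ji.
(* The cells need only cover almost surely. The terms of weight 2 and -1 form
   [1 - \sum_k \1_(C i k)] for [i = j] and [i = l]: they dominate [\1_W] when one of the two points
   misses every cell, and have mean 0 by [c_full]. *)
pose s := (-1, W) :: (2, setT) :: [seq (-1, C j k) | k <- index_enum 'I_m] ++
  [seq (-1, C l k) | k <- index_enum 'I_m] ++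
  [seq (1, E p) | p <- index_enum _] : seq (R * set T).
have sumE (F : set T -> R) : \sum_(p <- s) p.1 * F p.2 =
    - F W + 2 * F setT - \sum_k F (C j k) - \sum_k F (C l k) + \sum_p F (E p).
  rewrite /s !big_cons !big_cat !big_map /= mulN1r -!addrA -!sumrN.
  by congr (_ + (_ + (_ + (_ + _)))); apply: eq_bigr => k _; rewrite ?mulN1r ?mul1r.
have PC i : \sum_k fine (P (C i k)) = 1.
  by rewrite -c_full; apply: eq_bigr => k _; rewrite X_law.
have PE : \sum_p fine (P (E p)) =
    \sum_k \sum_k' r (c k) * r (c k') * (1 - r (J k `|` J k')) ^+ N.-2.
  rewrite pair_big /=; apply: eq_bigr => -[k k'] _ /=.
  by rewrite two_cells_prob//; exact: measurableU.
have : 0 <= \sum_(p <- s) p.1 * fine (P p.2); last first.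
  by rewrite (sumE (fun A => fine (P A))) !PC PE probability_setT /= -/W; lra.
apply: (@probability_combination_ge0 _ _ _ P) => [p|w].
  rewrite !in_cons !mem_cat => /orP[/eqP->//|/orP[/eqP->|]].
    exact: measurableT.
  by case/or3P => /mapP[k _ ->]; rewrite /C /=; [exact: mX|exact: mX|exact: mE].
rewrite (sumE (fun A => \1_A w)).
have C_le1 i : \sum_k \1_(C i k) w <= 1 :> R.
  under eq_bigr do rewrite indicE.
  rewrite -[1]/(true%:R); apply: sum_disjoint_le => // k k'; rewrite !inE.
  exact: c_disj.
have E_ge0 : 0 <= \sum_p \1_(E p) w :> R.
  by apply: sumr_ge0 => p _; rewrite indicE ler0n.
have W_le1 : \1_W w <= 1 :> R by rewrite indicE lern1 leq_b1.
have C_out i : ~ (exists k, c k (X i w)) -> \sum_k \1_(C i k) w = 0 :> R.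
  move=> out; apply: big1 => k _; rewrite indicE memNset// => ck.
  by apply: out; exists k.
have -> : \1_setT w = 1 :> R by rewrite indicE in_setT.
have := C_le1 j; have := C_le1 l.
have [[k ck]|/C_out ->] := pselect (exists k, c k (X j w)); last by lra.
have [[k' ck']|/C_out ->] := pselect (exists k, c k (X l w)); last by lra.
have [Ww|nW] := pselect (W w); last first.
  have -> : \1_W w = 0 :> R by rewrite indicE memNset.
  lra.
suff : 1 <= \sum_p \1_(E p) w :> R by lra.
rewrite (bigD1 (k, k'))//= [\1_(E _) w]indicE mem_set ?lerDl ?sumr_ge0//.
split => // i ij il [Jk|Jk'].
  have [lt_ji le_t] := J_near _ _ _ ck Jk.
  have := forallP Ww.1 i; rewrite leNgt lt_ji /= /gap_after ltNge.
  by rewrite le_t.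
have [lt_ji le_t] := J_near _ _ _ ck' Jk'.
have := forallP Ww.2 i; rewrite leNgt lt_ji /= /gap_after ltNge.
by rewrite le_t.
Qed.

End IndependentSample.

(** * The grid of cells and the mass of the exclusion zones *)

Section DensityLaw.
Context {R : realType}.
Variables (f : R -> R) (rho : probability R R).
Hypothesis f_ge0 : forall x, 0 <= f x.
Hypothesis mf : measurable_fun setT f.
Hypothesis rho_density : forall A, measurable A ->
  rho A = (\int[lebesgue_measure]_(x in A) (f x)%:E)%E.

Local Notation r A := (fine (rho A)).

Lemma law_le (A : set R) (ell b : R) : measurable A ->
  lebesgue_measure A = ell%:E -> 0 <= b -> (forall x, A x -> f x <= b) ->
  r A <= b * ell.
Proof.
move=> mA ellE b_ge0 f_le; rewrite -lee_fin fineK ?fin_num_measure// EFinM -ellE.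
rewrite rho_density// -integral_cst//; apply: ge0_le_integral => //=.
- by move=> x _; rewrite lee_fin.
- by apply/measurable_EFinP; exact: measurable_funTS.
Qed.

Lemma law_ge (A : set R) (ell b : R) : measurable A ->
  lebesgue_measure A = ell%:E -> 0 <= b -> (forall x, A x -> b <= f x) ->
  b * ell <= r A.
Proof.
move=> mA ellE b_ge0 f_ge; rewrite -lee_fin fineK ?fin_num_measure// EFinM -ellE.
rewrite rho_density// -integral_cst//; apply: ge0_le_integral => //=.
- by apply/measurable_EFinP; exact: measurable_funTS.
Qed.

Lemma lebesgue_itv_length (b1 b2 : bool) (u v : R) : u <= v ->
  lebesgue_measure [set` Interval (BSide b1 u) (BSide b2 v)] = (v - u)%:E.
Proof.
move=> uv; rewrite lebesgue_measure_itv /= lte_fin.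
by case: ltgtP uv => // ->; rewrite subrr.
Qed.

Lemma law0 (A : set R) : measurable A -> (forall x, A x -> f x = 0) -> r A = 0.
Proof.
by move=> mA f0; rewrite rho_density// integral0_eq// => x /f0 ->.
Qed.

Lemma law_ge0 (A : set R) : 0 <= r A.
Proof. by rewrite fine_ge0. Qed.

Lemma law_le1 (A : set R) : measurable A -> r A <= 1.
Proof. by move=> mA; rewrite -lee_fin fineK ?fin_num_measure// probability_le1. Qed.

Lemma lawU (A A' : set R) : measurable A -> measurable A' ->
  A `&` A' = set0 -> r (A `|` A') = r A + r A'.
Proof.
by move=> mA mA' AA'; rewrite measureU// fineD ?fin_num_measure.
Qed.

Section Cells.
Variables (L M S kappa tau t h : R) (N m : nat).
Hypotheses (L_ge0 : 0 <= L) (kappa_gt0 : 0 < kappa) (kappa_le_M : kappa <= M).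
Hypotheses (tau_gt0 : 0 < tau) (tau_le : tau <= 1 / 4).
Hypotheses (t_gt0 : 0 < t) (h_gt0 : 0 < h) (N_gt0 : (0 < N)%N).
Hypothesis f_lip : forall x y, `|f x - f y| <= L * `|x - y|.
Hypothesis f_le : forall x, f x <= M.
Hypothesis f_supp : forall x, f x != 0 -> - S <= x < S.
Hypothesis mh : m%:R * h = 2 * S.

(** This bounds the scale [t / (N f)] on the good cells. The two hypotheses that follow make a cell
    short compared with each such scale, up to the tolerance [tau], and make [f] constant up to a
    factor between [1 - tau] and [1 + tau] over a length [3 * a], which contains all the zones. *)
Let a : R := t / (N%:R * kappa).
Hypothesis h_le : h <= tau * (t / (N%:R * M)).
Hypothesis a_small : L * (3 * a) <= tau * kappa.

Let y (k : 'I_m) : R := - S + k%:R * h.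
Definition cell (k : 'I_m) : set R := `[y k, y k + h[%classic.
Definition good_cell (k : 'I_m) : bool := kappa <= f (y k).

(** Write [w] for [t / (N%:R * f (y k))]. On a good cell, a point is at most [h <= tau * w] past
    [y k], and its own scale is at most [w / (1 - tau) <= (1 + 2 * tau) * w]; hence the factor
    [1 + 3 * tau]. *)
Definition outer_gap (k : 'I_m) : set R :=
  `[y k, y k + (1 + 3 * tau) * (t / (N%:R * f (y k)))]%classic.
(** It starts after the cell, hence to the right of all its points, and is short enough to be within
    the scale of each of them. On a bad cell it is empty, so it excludes nothing. *)
Definition inner_gap (k : 'I_m) : set R :=
  if good_cell k then `]y k + h, y k + (1 - tau) * (t / (N%:R * f (y k)))]%classic
  else set0.

Let N_gt0R : 0 < N%:R :> R. Proof. by rewrite ltr0n. Qed.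
Let M_gt0 : 0 < M. Proof. exact: lt_le_trans kappa_le_M. Qed.
Let a_gt0 : 0 < a. Proof. by rewrite divr_gt0 ?mulr_gt0. Qed.

Let w_gt0 k : good_cell k -> 0 < f (y k).
Proof. exact: lt_le_trans. Qed.

Let w_le_a k : good_cell k -> t / (N%:R * f (y k)) <= a.
Proof.
move=> gk; rewrite ler_pM2l// lef_pV2 ?posrE ?mulr_gt0 ?(w_gt0 gk)//.
by rewrite ler_pM2l.
Qed.

Let h_le_w k : good_cell k -> h <= tau * (t / (N%:R * f (y k))).
Proof.
move=> gk; apply: (le_trans h_le); rewrite ler_pM2l// ler_pM2l//.
by rewrite lef_pV2 ?posrE ?mulr_gt0 ?(w_gt0 gk)// ler_pM2l.
Qed.

Let h_le_a : h <= tau * a.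
Proof.
apply: (le_trans h_le); rewrite ler_pM2l// ler_pM2l//.
by rewrite lef_pV2 ?posrE ?mulr_gt0// ler_pM2l.
Qed.

Let tau_sq : 0 <= tau * (1 - 4 * tau).
Proof. by rewrite mulr_ge0 ?(ltW tau_gt0)//; move: tau_le; lra. Qed.

Let three_a c w : 0 < w -> w <= a -> c <= 3 -> c * w <= 3 * a.
Proof.
move=> w_gt wa c3; apply: (@le_trans _ _ (3 * w)); first by rewrite ler_pM2r.
by rewrite ler_pM2l.
Qed.

Let h_le_3a : h <= 3 * a.
Proof. by apply: (le_trans h_le_a); rewrite ler_pM2r//; move: tau_le; lra. Qed.

Let f_near k x : good_cell k -> y k <= x <= y k + 3 * a ->
  (1 - tau) * f (y k) <= f x <= (1 + tau) * f (y k).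
Proof.
move=> gk /andP[yx xy].
have : `|f x - f (y k)| <= tau * f (y k).
  apply: (le_trans (f_lip _ _)); rewrite ger0_norm ?subr_ge0//.
  apply: (@le_trans _ _ (L * (3 * a))); first by rewrite ler_wpM2l// lerBlDl.
  by apply: (le_trans a_small); rewrite ler_pM2l.
by rewrite ler_norml => /andP[? ?]; apply/andP; split; lra.
Qed.

Lemma measurable_cell k : measurable (cell k).
Proof. exact: measurable_itv. Qed.

Lemma measurable_outer_gap k : measurable (outer_gap k).
Proof. exact: measurable_itv. Qed.

Lemma measurable_inner_gap k : measurable (inner_gap k).
Proof. by rewrite /inner_gap; case: ifP. Qed.

Lemma cell_disjoint k k' x : cell k x -> cell k' x -> k = k'.
Proof.
rewrite /cell /= !in_itv /= => /andP[kx xk] /andP[kx' xk'].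
have lt_S (i j : 'I_m) : y i <= x -> x < y j + h -> (i <= j)%N.
  move=> ix xj; rewrite -ltnS -(ltr_nat R) -(ltr_pM2r h_gt0).
  have := le_lt_trans ix xj; rewrite /y -natr1 mulrDl mul1r.
  by move: (i%:R * h) (j%:R * h) => p q; lra.
by apply/val_inj/eqP; rewrite eqn_leq !lt_S.
Qed.

Lemma cell_cover x : - S <= x < S -> exists k, cell k x.
Proof.
move=> /andP[Sx xS].
have q_ge0 : 0 <= (x + S) / h by rewrite divr_ge0 ?(ltW h_gt0)//; lra.
have [k /andP[k_le lt_k]] : exists k, k%:R <= (x + S) / h < k.+1%:R.
  by exists (Num.truncn ((x + S) / h)); exact: truncn_itv.
have k_lt : (k < m)%N.
  rewrite -(ltr_nat R); apply: (le_lt_trans k_le).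
  by rewrite ltr_pdivrMr// mh; lra.
exists (Ordinal k_lt); rewrite /cell /= in_itv /= /y /=.
move: k_le lt_k; rewrite ler_pdivlMr// ltr_pdivrMr// -natr1 mulrDl mul1r.
by move: (k%:R * h) => p ? ?; apply/andP; split; lra.
Qed.

(** The cells are disjoint, and the density vanishes off their union. *)
Lemma cell_law_sum : \sum_k r (cell k) = 1.
Proof.
pose C := \bigcup_(k in [set: 'I_m]) cell k.
have mC : measurable C.
  apply: fin_bigcup_measurable => [|k _]; first exact: finite_finset.
  exact: measurable_cell.
pose l := (1, C) :: [seq (-1, cell k) | k <- index_enum 'I_m] : seq (R * set R).
have l_meas p : p \in l -> measurable p.2.
  by rewrite in_cons => /orP[/eqP->//|/mapP[k _ ->]]; exact: measurable_cell.
have sumE (F : set R -> R) : \sum_(p <- l) p.1 * F p.2 = F C - \sum_k F (cell k).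
  rewrite /l big_cons big_map /= mul1r -sumrN.
  by congr (_ + _); apply: eq_bigr => k _; rewrite mulN1r.
have l0 w : \sum_(p <- l) p.1 * \1_(p.2) w = 0.
  rewrite (sumE (fun A => \1_A w)); have [[k _ ck]|nC] := pselect (C w).
    rewrite (bigD1 k)//= !indicE !mem_set//; last by exists k.
    rewrite big1 ?addr0 ?subrr// => i ik; rewrite indicE memNset// => ci.
    by rewrite (cell_disjoint ci ck) eqxx in ik.
  rewrite indicE memNset// big1 ?subrr// => k _.
  by rewrite indicE memNset// => ck; apply: nC; exists k.
have : \sum_(p <- l) p.1 * r p.2 = 0.
  apply: EFin_inj; rewrite -(integrable_indicator_combination rho l_meas).2.
  by under eq_integral do rewrite l0; rewrite integral0.
rewrite (sumE (fun A => r A)) => /eqP; rewrite subr_eq0 => /eqP <-.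
have : r (~` C) = 0.
  apply: law0 => [|x nCx]; first exact: measurableC.
  by have [//|/f_supp/cell_cover[k ck]] := eqVneq (f x) 0; case: nCx; exists k.
rewrite probability_setC// -[rho C]fineK ?fin_num_measure// -EFinB /=; lra.
Qed.

(** Here the density cancels: the zone has length proportional to [1 / f (y k)] and [f] is nearly
    [f (y k)] on it, so its mass is about [t / N] whatever the cell. The constant comes from
    [(1 + tau) * (1 + 3 * tau) <= 1 + 6 * tau]. *)
Lemma outer_gap_law_le k : good_cell k -> r (outer_gap k) <= (1 + 6 * tau) * t / N%:R.
Proof.
move=> gk; have fk := w_gt0 gk; have wa := w_le_a gk.
have tau0 := tau_gt0; have tau4 := tau_le; have tau2 := tau_sq; have t0 := t_gt0.
rewrite /outer_gap; set w := t / _ in wa *; have w_gt : 0 < w by rewrite divr_gt0 ?mulr_gt0.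
have len_ge0 : 0 <= (1 + 3 * tau) * w.
  by rewrite mulr_ge0 ?(ltW w_gt)//; move: tau_gt0; lra.
apply: (@le_trans _ _ ((1 + tau) * f (y k) * ((1 + 3 * tau) * w))).
  apply: law_le => //.
  - by rewrite lebesgue_itv_length ?lerDl// addrAC subrr add0r.
  - by rewrite mulr_ge0//; lra.
  - move=> x; rewrite /= in_itv /= -/w => /andP[yx xy].
    have /andP[//] : (1 - tau) * f (y k) <= f x <= (1 + tau) * f (y k).
    by apply: f_near => //; rewrite yx (le_trans xy)// lerD2l three_a//; lra.
have -> : (1 + tau) * f (y k) * ((1 + 3 * tau) * w) =
    (1 + tau) * (1 + 3 * tau) * t / N%:R.
  by rewrite /w; field; rewrite !gt_eqF.
rewrite ler_pM2r ?invr_gt0// ler_pM2r//; nra.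
Qed.

Lemma outer_gapP k x z : good_cell k -> cell k x -> ~ outer_gap k z ->
  (z < x) || (t < N%:R * f x * (z - x)).
Proof.
move=> gk; have fk := w_gt0 gk; have wa := w_le_a gk;
have tau0 := tau_gt0; have tau4 := tau_le; have tau2 := tau_sq.
have t0 := t_gt0; have hw := h_le_w gk.
rewrite /cell /outer_gap /= !in_itv /=.
set w := t / _ in wa hw *; have w_gt : 0 < w by rewrite divr_gt0 ?mulr_gt0.
have tE : t = N%:R * f (y k) * w by rewrite /w; field; rewrite !gt_eqF.
move=> /andP[yx xy] nz; have [//|xz] := ltrP z x; rewrite /=.
have {}nz : y k + (1 + 3 * tau) * w < z.
  by rewrite ltNge; apply/negP => zy; apply: nz; rewrite zy andbT (le_trans yx).
have /andP[f_ge _] : (1 - tau) * f (y k) <= f x <= (1 + tau) * f (y k).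
  by apply: f_near => //; rewrite yx (le_trans (ltW xy))// lerD2l.
rewrite [ltLHS]tE -!mulrA ltr_pM2l//.
(* The position inside the cell uses up [tau * w]; the remaining [1 + 2 * tau] compensates for
   [f x >= (1 - tau) * f (y k)], as [tau] is at most 1/4. *)
apply: (@le_lt_trans _ _ ((1 - tau) * f (y k) * ((1 + 2 * tau) * w))).
  have -> : (1 - tau) * f (y k) * ((1 + 2 * tau) * w) =
    (f (y k) * w) * ((1 - tau) * (1 + 2 * tau)) by ring.
  by rewrite ler_peMr ?(mulr_ge0 (ltW fk) (ltW w_gt))//; nra.
have zx : (1 + 2 * tau) * w < z - x by lra.
have fx : 0 < f x by apply: lt_le_trans f_ge; rewrite mulr_gt0//; lra.
apply: (@le_lt_trans _ _ (f x * ((1 + 2 * tau) * w))); last by rewrite ltr_pM2l.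
by rewrite ler_wpM2r// mulr_ge0 ?ltW//; lra.
Qed.

Lemma inner_gapP k x z : cell k x -> inner_gap k z ->
  x < z /\ N%:R * f x * (z - x) <= t.
Proof.
rewrite /inner_gap; case: ifP => // gk.
have fk := w_gt0 gk; have wa := w_le_a gk; have t0 := t_gt0;
have tau0 := tau_gt0; have tau4 := tau_le; have tau2 := tau_sq; have hw := h_le_w gk.
rewrite /cell /= !in_itv /=.
set w := t / _ in wa hw *; have w_gt : 0 < w by rewrite divr_gt0 ?mulr_gt0.
have tE : t = N%:R * f (y k) * w by rewrite /w; field; rewrite !gt_eqF.
move=> /andP[yx xy] /andP[yz zy]; have xz : x < z by exact: lt_trans yz.
split=> //.
have /andP[f_ge f_le'] : (1 - tau) * f (y k) <= f x <= (1 + tau) * f (y k).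
  by apply: f_near => //; rewrite yx (le_trans (ltW xy))// lerD2l.
rewrite [leRHS]tE -!mulrA ler_pM2l//.
apply: (@le_trans _ _ ((1 + tau) * f (y k) * ((1 - tau) * w))).
  by apply: ler_pM => //; [rewrite subr_ge0 ltW|lra].
have -> : (1 + tau) * f (y k) * ((1 - tau) * w) =
    (f (y k) * w) * ((1 + tau) * (1 - tau)) by ring.
by rewrite ler_piMr ?(mulr_ge0 (ltW fk) (ltW w_gt))//; nra.
Qed.

Lemma inner_gap_law_ge k : good_cell k ->
  (1 - 3 * tau) * t / N%:R <= r (inner_gap k).
Proof.
move=> gk; have fk := w_gt0 gk; have wa := w_le_a gk;
have tau0 := tau_gt0; have tau4 := tau_le; have tau2 := tau_sq.
have t0 := t_gt0; have hw := h_le_w gk.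
rewrite /inner_gap gk.
set w := t / _ in wa hw *; have w_gt : 0 < w by rewrite divr_gt0 ?mulr_gt0.
have len_ge0 : y k + h <= y k + (1 - tau) * w.
  by rewrite lerD2l (le_trans hw)// ler_pM2r//; lra.
apply: (@le_trans _ _ ((1 - tau) * f (y k) * ((1 - tau) * w - h))); last first.
  apply: law_ge => //.
  - by rewrite lebesgue_itv_length//; congr (_%:E); ring.
  - by rewrite mulr_ge0//; lra.
  - move=> x; rewrite /= in_itv /= => /andP[yx xy].
    have /andP[//] : (1 - tau) * f (y k) <= f x <= (1 + tau) * f (y k).
    apply: f_near => //; apply/andP; split.
      by rewrite (le_trans _ (ltW yx))// lerDl ltW.
    by rewrite (le_trans xy)// lerD2l three_a//; lra.
apply: (@le_trans _ _ ((1 - tau) * f (y k) * ((1 - 2 * tau) * w))); last first.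
  by rewrite ler_wpM2l ?mulr_ge0//; lra.
have -> : (1 - tau) * f (y k) * ((1 - 2 * tau) * w) =
    (1 - tau) * (1 - 2 * tau) * t / N%:R.
  by rewrite /w; field; rewrite !gt_eqF.
rewrite ler_pM2r ?invr_gt0// ler_pM2r//; nra.
Qed.

Lemma inner_gap_disjoint k k' : y k + a <= y k' ->
  inner_gap k `&` inner_gap k' = set0.
Proof.
move=> kk'; apply/seteqP; split => // x []; rewrite /inner_gap.
case: ifP => // gk; case: ifP => // gk'; rewrite /= !in_itv /=.
move=> /andP[_ x_le] /andP[x_gt _]; have wa := w_le_a gk.
have w_gt : 0 < t / (N%:R * f (y k)) by rewrite divr_gt0 ?mulr_gt0 ?(w_gt0 gk).
set w := t / _ in wa w_gt x_le.
suff : (1 - tau) * w <= a by move: h_gt0; lra.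
by apply: le_trans wa; rewrite ler_piMl ?ltW//; move: tau_gt0; lra.
Qed.

(** By the Lipschitz bound [f] stays below [2 * kappa] on a bad cell, and all cells together have
    length [2 * S]. *)
Lemma bad_cells_law_le : \sum_(k | ~~ good_cell k) r (cell k) <= 4 * kappa * S.
Proof.
have kap := kappa_gt0; have tau4 := tau_le; have h0 := h_gt0.
apply: (@le_trans _ _ (\sum_(k < m) 2 * kappa * h)); last first.
  rewrite sumr_const card_ord -[_ *+ m]mulr_natl mulrCA mh; lra.
rewrite big_mkcond; apply: ler_sum => k _.
case: ifPn => [|_]; last by rewrite !mulr_ge0 ?ltW.
rewrite -ltNge => f_lt; apply: law_le => //; first exact: measurable_cell.
- rewrite lebesgue_itv_length ?lerDl ?ltW//; congr (_%:E); ring.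
- by rewrite mulr_ge0 ?ltW.
move=> x; rewrite /cell /= in_itv /= => /andP[yx xy].
have : `|f x - f (y k)| <= tau * kappa.
  apply: (le_trans (f_lip _ _)); rewrite ger0_norm ?subr_ge0//.
  apply: le_trans a_small; rewrite ler_wpM2l// lerBlDl.
  by rewrite (le_trans (ltW xy))// lerD2l.
have tk : tau * kappa <= 1 / 4 * kappa by rewrite ler_pM2r.
by rewrite ler_norml => /andP[_ ?]; lra.
Qed.

(** These cells lie in an interval of length [2 * a + h <= 3 * a]. They are the ones whose inner
    gaps may overlap that of [k]. *)
Lemma near_cells_law_le k :
  \sum_(k' | `|y k - y k'| < a) r (cell k') <= M * (3 * a).
Proof.
have a0 := a_gt0; have h0 := h_gt0; have tau4 := tau_le.
pose I := `[y k - a, y k + a + h]%classic.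
have mI : measurable I by exact: measurable_itv.
apply: (@le_trans _ _ (r I)); last first.
  apply: (@le_trans _ _ (M * (y k + a + h - (y k - a)))).
    by apply: law_le => //; [rewrite lebesgue_itv_length//; lra|exact: ltW].
  rewrite ler_pM2l//.
  have ta : tau * a <= 1 / 4 * a by rewrite ler_pM2r.
  by have := h_le_a; lra.
pose near := fun k' => `|y k - y k'| < a.
pose l := (1, I) :: [seq (-1, cell k') | k' <- index_enum 'I_m & near k'] :
  seq (R * set R).
have sumE (F : set R -> R) :
    \sum_(p <- l) p.1 * F p.2 = F I - \sum_(k' | near k') F (cell k').
  rewrite /l big_cons big_map big_filter /= mul1r -sumrN.
  by congr (_ + _); apply: eq_bigr => i _; rewrite mulN1r.
rewrite -subr_ge0 -(sumE (fun A => r A)).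
apply: (@probability_combination_ge0 _ _ _ rho) => [p|w].
  by rewrite in_cons => /orP[/eqP->//|/mapP[i _ ->]]; exact: measurable_cell.
rewrite (sumE (fun A => \1_A w)) subr_ge0.
rewrite [leLHS](_ : _ = \sum_k' (near k' && (w \in cell k'))%:R); last first.
  by rewrite big_mkcond; apply: eq_bigr => i _; rewrite indicE; case: (near i).
rewrite indicE; apply: sum_disjoint_le => [i i' /andP[_]|i /andP[near_i]]; rewrite !inE.
  by move=> ci /andP[_]; rewrite inE; exact: cell_disjoint ci.
rewrite /cell /I /= !in_itv /= => /andP[iw wi].
by move: near_i; rewrite /near ltr_norml => /andP[? ?]; apply/andP; split; lra.
Qed.

Section Sample.
Context d (T : measurableType d) (P : probability T R) (X : 'I_N -> {RV P >-> R}).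
Hypothesis X_indep : mutually_independent X.
Hypothesis X_law : forall i A, measurable A -> P (X i @^-1` A) = rho A.

Lemma strictly_isolated_law_ge j : (1 + 6 * tau) * t / N%:R <= 1 ->
  (1 - 4 * kappa * S) * (1 - (1 + 6 * tau) * t / N%:R) ^+ N.-1 <=
  fine (P [set w | strictly_isolated f t (X^~ w) j]).
Proof.
move=> q_le1.
apply: le_trans (@strictly_isolated_prob_ge _ _ _ _ _ _ _ X_indep X_law _ _ mf
  _ cell outer_gap measurable_cell measurable_outer_gap cell_disjoint
  good_cell _ j q_le1 outer_gap_law_le outer_gapP).
rewrite ler_wpM2r ?exprn_ge0 ?subr_ge0// lerBlDr -[leLHS]cell_law_sum.
by rewrite (bigID good_cell) /= lerD2l bad_cells_law_le.
Qed.

(** If a cell is bad or the two are near, one of the indicators already bounds the power, which is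
    at most 1. Otherwise the inner gaps are disjoint, their masses add up, and [1 - x <= expR (- x)]
    applies. *)
Let escape_le k k' :
  (1 - r (inner_gap k `|` inner_gap k')) ^+ N.-2 <=
  expR (- (N.-2%:R * (2 * (1 - 3 * tau) * t / N%:R))) + (~~ good_cell k)%:R +
  (~~ good_cell k')%:R + (`|y k - y k'| < a)%R%:R.
Proof.
have mU : measurable (inner_gap k `|` inner_gap k').
  by apply: measurableU; exact: measurable_inner_gap.
have r_ge0 := law_ge0 (inner_gap k `|` inner_gap k').
have r_le1 := law_le1 mU.
set E := expR _; have E_ge0 : 0 <= E by exact: expR_ge0.
have pow_le1 : (1 - r (inner_gap k `|` inner_gap k')) ^+ N.-2 <= 1.
  by rewrite exprn_ile1 ?subr_ge0// lerBlDr lerDl.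
have [gk|_] := boolP (good_cell k); last first.
  apply: (le_trans pow_le1).
  by rewrite -addrA -addrA addrCA lerDl !addr_ge0.
have [gk'|_] := boolP (good_cell k'); last first.
  by apply: (le_trans pow_le1); rewrite -addrA addrCA lerDl !addr_ge0.
have [_|far] := ltrP `|y k - y k'| a.
  by apply: (le_trans pow_le1); rewrite addrC lerDl !addr_ge0.
rewrite !addr0 /E -mulrN expRM_natl lerXn2r ?nnegrE ?subr_ge0 ?expR_ge0//.
apply: le_trans (expR_ge1Dx _) _; rewrite ?lerD2l//.
rewrite ler_expR lerN2.
have -> : r (inner_gap k `|` inner_gap k') = r (inner_gap k) + r (inner_gap k').
  apply: lawU; [exact: measurable_inner_gap|exact: measurable_inner_gap|].
  move: far; rewrite ler_normr => /orP[far|far].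
    by rewrite setIC; apply: inner_gap_disjoint; lra.
  by apply: inner_gap_disjoint; lra.
have := inner_gap_law_ge gk; have := inner_gap_law_ge gk'; lra.
Qed.

(** Average [escape_le] over both cells: each bad-cell indicator costs [4 * kappa * S], and
    proximity costs [M * (3 * a)], which tends to 0 with [1 / N]. *)
Lemma weakly_isolated_pair_law_le j l : j != l ->
  fine (P [set w | weakly_isolated f t (X^~ w) j /\
                   weakly_isolated f t (X^~ w) l]) <=
  expR (- (N.-2%:R * (2 * (1 - 3 * tau) * t / N%:R))) + 8 * kappa * S + M * (3 * a).
Proof.
move=> jl.
apply: le_trans (@weakly_isolated_pair_prob_le _ _ _ _ _ _ _ X_indep X_law _ _ mf
  _ cell inner_gap measurable_cell measurable_inner_gap cell_disjoint
  j l jl cell_law_sum inner_gapP) _.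
set E := expR _.
pose b k : R := (~~ good_cell k)%:R.
apply: (@le_trans _ _ (\sum_k \sum_k' r (cell k) * r (cell k') *
    (E + b k + b k' + (`|y k - y k'| < a)%R%:R))).
  apply: ler_sum => k _; apply: ler_sum => k' _.
  by rewrite ler_wpM2l ?mulr_ge0 ?law_ge0// escape_le.
have bad : \sum_k r (cell k) * b k <= 4 * kappa * S.
  apply: le_trans bad_cells_law_le; rewrite [leRHS]big_mkcond.
  by apply: ler_sum => k _; rewrite /b; case: (good_cell k); rewrite /= ?mulr0 ?mulr1.
have inner k : \sum_k' r (cell k) * r (cell k') *
      (E + b k + b k' + (`|y k - y k'| < a)%R%:R) <=
    r (cell k) * (E + 4 * kappa * S + M * (3 * a)) + r (cell k) * b k.
  have -> : \sum_k' r (cell k) * r (cell k') *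
      (E + b k + b k' + (`|y k - y k'| < a)%R%:R) =
    r (cell k) * ((E + b k) * \sum_k' r (cell k') + \sum_k' r (cell k') * b k' +
      \sum_(k' | `|y k - y k'| < a) r (cell k')).
    rewrite [X in _ = _ * (_ + X)]big_mkcond mulr_sumr -!big_split mulr_sumr.
    apply: eq_bigr => k' _; case: ifP => _ /=; ring.
  rewrite cell_law_sum mulr1.
  have := near_cells_law_le k; have rk := law_ge0 (cell k); move: bad.
  set x1 := \sum_k' _ ; set x2 := \sum_(k' | _) _ => h1 h2.
  rewrite -mulrDr ler_wpM2l//; lra.
apply: le_trans (ler_sum _ (fun k _ => inner k)) _.
rewrite big_split /= -mulr_suml cell_law_sum mul1r; lra.
Qed.

End Sample.

End Cells.
End DensityLaw.

(** * Choice of the parameters and the limit of the isolation probabilities *)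

Section IsolationAsymptotics.
Context {R : realType}.

(** The inverse of [1 - q] is [1 + q / (1 - q)], which is at most [expR (q / (1 - q))]. *)
Lemma expR_le_exprn (q x : R) n : 0 <= q < 1 -> n%:R * (q / (1 - q)) <= x ->
  expR (- x) <= (1 - q) ^+ n.
Proof.
move=> /andP[q_ge0 q_lt1] le_x; have q1 : 0 < 1 - q by rewrite subr_gt0.
have base : expR (- (q / (1 - q))) <= 1 - q.
  rewrite expRN -[leRHS]invrK lef_pV2 ?posrE ?invr_gt0 ?expR_gt0//.
  apply: le_trans (expR_ge1Dx _).
  have -> : 1 + q / (1 - q) = (1 - q)^-1 by field; rewrite gt_eqF.
  by [].
apply: (@le_trans _ _ (expR (n%:R * - (q / (1 - q))))).
  by rewrite ler_expR mulrN lerN2.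
by rewrite expRM_natl lerXn2r ?nnegrE ?expR_ge0// ltW.
Qed.

Variables (f : R -> R) (rho : probability R R) (L M S : R).
Hypothesis f_ge0 : forall x, 0 <= f x.
Hypothesis mf : measurable_fun setT f.
Hypothesis rho_density : forall A, measurable A ->
  rho A = (\int[lebesgue_measure]_(x in A) (f x)%:E)%E.
Hypotheses (L_ge0 : 0 <= L) (S_gt0 : 0 < S).
Hypothesis f_lip : forall x y, `|f x - f y| <= L * `|x - y|.
Hypothesis f_le : forall x, f x <= M.
Hypothesis f_supp : forall x, f x != 0 -> - S <= x < S.

(** [tau] and [kappa] are fixed before [N0], while the grid depends on [N]. Since [N0] precedes the
    probability space, the sample may live on a different space for each [N]. *)
Lemma isolated_asymptotics (t eta : R) : 0 < t -> 0 < eta ->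
  exists N0 : nat, forall N, (N0 <= N)%N ->
  forall d (T : measurableType d) (P : probability T R)
    (X : 'I_N -> {RV P >-> R}), mutually_independent X ->
  (forall i A, measurable A -> P (X i @^-1` A) = rho A) ->
  (forall j, expR (- t) - eta <=
     fine (P [set w | strictly_isolated f t (X^~ w) j])) /\
  (forall j l, j != l ->
     fine (P [set w | weakly_isolated f t (X^~ w) j /\
                      weakly_isolated f t (X^~ w) l]) <=
     expR (- (2 * t)) + eta).
Proof.
move=> t_gt0 eta_gt0; have S0 := S_gt0.
have [tau [tau_gt0 [tau_le tau_t]]] :
    exists tau : R, 0 < tau /\ tau <= 1 / 4 /\ tau * t * 64 <= eta.
  have den_gt0 : 0 < 64 * (1 + t) / eta by rewrite divr_gt0//; lra.
  pose tau : R := (4 + 64 * (1 + t) / eta)^-1.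
  have tau_gt0 : 0 < tau by rewrite invr_gt0; lra.
  have tauE : tau * (4 + 64 * (1 + t) / eta) = 1 by rewrite mulVf// gt_eqF//; lra.
  have prod_ge0 : 0 <= tau * (64 * (1 + t) / eta) by rewrite mulr_ge0 ?ltW.
  have prod_le1 : tau * (64 * (1 + t)) / eta <= 1.
    by move: tauE; rewrite mulrDr mulrA; lra.
  exists tau; split; [by []|split]; first by move: tauE; rewrite mulrDr; lra.
  by move: prod_le1; rewrite ler_pdivrMr// mul1r; lra.
have [kappa [kappa_gt0 kappa_S]] : exists kappa : R, 0 < kappa /\ kappa * S * 32 <= eta.
  exists (eta / (32 * (S + 1))); split; first by rewrite divr_gt0//; lra.
  have : eta / (32 * (S + 1)) * (32 * (S + 1)) = eta by rewrite divfK// gt_eqF//; lra.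
  have : 0 < eta / (32 * (S + 1)) by rewrite divr_gt0//; lra.
  by move: (eta / _) => kappa; lra.
have M_ge0 : 0 <= M by exact: le_trans (f_ge0 0) (f_le 0).
have [M' M'E] : exists M', M' = M + kappa by exists (M + kappa).
have M'_gt0 : 0 < M' by rewrite M'E; lra.
have M'_ge : kappa <= M' by rewrite M'E; lra.
have f_le' x : f x <= M' by rewrite (le_trans (f_le x))// M'E; lra.
(* Lower bounds for [N] that give, in order: [a_small]; a cost of at most [eta / 4] for nearby
   cells; [q <= tau]; and [(1 - tau) * N%:R <= N.-2%:R]. *)
pose c1 := 3 * L * t / (tau * kappa ^+ 2).
pose c2 := 12 * M' * t / (kappa * eta).
pose c3 := (1 + 6 * tau) * t / tau.
pose c4 := 2 / tau.
have [tau0 kappa0] := (ltW tau_gt0, ltW kappa_gt0).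
have [t0 [eta0 M'0]] := (ltW t_gt0, (ltW eta_gt0, ltW M'_gt0)).
have tau6 : 0 <= 1 + 6 * tau by lra.
have c1_ge0 : 0 <= c1 by rewrite divr_ge0 ?mulr_ge0 ?(mulr_ge0, exprn_ge0).
have c2_ge0 : 0 <= c2 by rewrite divr_ge0 ?mulr_ge0 ?(mulr_ge0, ler0n).
have c3_ge0 : 0 <= c3 by rewrite divr_ge0 ?mulr_ge0 ?(mulr_ge0, ler0n).
have c4_ge0 : 0 <= c4 by rewrite divr_ge0.
exists (Num.truncn (c1 + c2 + c3 + c4)).+1 => N N_ge d T P X X_indep X_law.
have N_gt0 : (0 < N)%N by exact: leq_trans N_ge.
have N_gt0R : 0 < N%:R :> R by rewrite ltr0n.
have c_le : c1 + c2 + c3 + c4 <= N%:R.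
  by apply: (@le_trans _ _ (Num.truncn (c1 + c2 + c3 + c4)).+1%:R);
    rewrite ?ler_nat// ltW// truncnS_gt.
have [n1 n2 n3 n4] : [/\ c1 <= N%:R, c2 <= N%:R, c3 <= N%:R & c4 <= N%:R].
  by split; lra.
have a_small : L * (3 * (t / (N%:R * kappa))) <= tau * kappa.
  move: n1; rewrite /c1 ler_pdivrMr ?mulr_gt0 ?exprn_gt0// => n1.
  rewrite !mulrA ler_pdivrMr ?mulr_gt0//; nra.
have near_small : M' * (3 * (t / (N%:R * kappa))) <= eta / 4.
  move: n2; rewrite /c2 ler_pdivrMr ?mulr_gt0// => n2.
  rewrite !mulrA ler_pdivrMr ?mulr_gt0//; nra.
pose q := (1 + 6 * tau) * t / N%:R.
have q_le : q <= tau.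
  by rewrite /q ler_pdivrMr//; move: n3; rewrite /c3 ler_pdivrMr// [N%:R * tau]mulrC.
have q_ge0 : 0 <= q by rewrite divr_ge0 ?mulr_ge0 ?(mulr_ge0, ler0n).
pose m := (Num.truncn (2 * S * (N%:R * M') / (tau * t))).+1.
have m_gt0R : 0 < m%:R :> R by rewrite ltr0n.
pose h := 2 * S / m%:R.
have h_gt0 : 0 < h by rewrite !mulr_gt0 ?invr_gt0.
have mh : m%:R * h = 2 * S by rewrite /h mulrCA divff ?mulr1// gt_eqF.
have h_le : h <= tau * (t / (N%:R * M')).
  have m_gt : 2 * S * (N%:R * M') / (tau * t) < m%:R by exact: truncnS_gt.
  move: m_gt; rewrite ltr_pdivrMr ?mulr_gt0// => m_gt.
  rewrite /h ler_pdivrMr//.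
  have -> : tau * (t / (N%:R * M')) * m%:R = m%:R * (tau * t) / (N%:R * M') by ring.
  by rewrite ler_pdivlMr ?mulr_gt0// ltW.
split=> [j|j l jl].
  have q_le1 : q <= 1 by apply: (le_trans q_le); lra.
  apply: le_trans (strictly_isolated_law_ge f_ge0 mf rho_density L_ge0 kappa_gt0
    M'_ge tau_gt0 tau_le t_gt0 h_gt0 N_gt0 f_lip f_le' f_supp mh h_le a_small
    X_indep X_law j q_le1).
  rewrite -/q.
  have q_lt1 : 0 <= q < 1 by rewrite q_ge0 (le_lt_trans q_le)//; lra.
  (* With [q <= tau <= 1/4], [(1 + 6 * tau) / (1 - q)] is at most [1 + 14 * tau]. *)
  have pow_ge : expR (- ((1 + 14 * tau) * t)) <= (1 - q) ^+ N.-1.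
    apply: expR_le_exprn => //.
    have : N.-1%:R <= N%:R :> R by rewrite ler_nat leq_pred.
    have qN : N%:R * q = (1 + 6 * tau) * t by rewrite /q mulrCA divff ?mulr1// gt_eqF.
    rewrite mulrA ler_pdivrMr; last by lra.
    move=> le_N; apply: (@le_trans _ _ (N%:R * q)); first by rewrite ler_wpM2r.
    rewrite qN mulrAC ler_pM2r//; nra.
  have e_split : expR (- t) - 14 * (tau * t) <= expR (- ((1 + 14 * tau) * t)).
    have -> : - ((1 + 14 * tau) * t) = - t + - (14 * (tau * t)) by ring.
    rewrite expRD.
    have e1 : expR (- t) <= 1 by rewrite -expR0 ler_expR oppr_le0 ltW.
    have e2 : 1 - 14 * (tau * t) <= expR (- (14 * (tau * t))) := expR_ge1Dx _.
    have tt : 0 <= tau * t by rewrite mulr_ge0.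
    apply: (@le_trans _ _ (expR (- t) * (1 - 14 * (tau * t)))).
      by rewrite mulrBr mulr1 lerD2l lerN2 ler_piMl ?mulr_ge0.
    by rewrite ler_pM2l ?expR_gt0.
  have pow_le1 : (1 - q) ^+ N.-1 <= 1.
    by rewrite exprn_ile1 ?subr_ge0 ?(le_trans q_le)//; lra.
  have pow_ge0 : 0 <= (1 - q) ^+ N.-1.
    by rewrite exprn_ge0 ?subr_ge0//; lra.
  have kS : 4 * kappa * S * (1 - q) ^+ N.-1 <= 4 * kappa * S.
    by rewrite ler_piMr// !mulr_ge0// ltW.
  rewrite mulrBl mul1r; lra.
have := weakly_isolated_pair_law_le f_ge0 mf rho_density L_ge0 kappa_gt0 M'_ge
    tau_gt0 tau_le t_gt0 h_gt0 N_gt0 f_lip f_le' f_supp mh h_le a_small X_indep X_law jl.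
move=> /le_trans; apply.
have N2 : (1 - tau) * N%:R <= N.-2%:R.
  have : N%:R <= N.-2%:R + 2 :> R.
    by rewrite -natrD ler_nat; case: (N) => [|[|k]] //; rewrite addn2.
  by move: n4; rewrite /c4 ler_pdivrMr//; lra.
(* One factor [1 - tau] pays for replacing [N.-2] by [N], and
   [(1 - tau) * (1 - 3 * tau) >= 1 - 4 * tau]. *)
have expo : 2 * (1 - 4 * tau) * t <= N.-2%:R * (2 * (1 - 3 * tau) * t / N%:R).
  rewrite mulrA ler_pdivlMr//.
  apply: (@le_trans _ _ ((1 - tau) * N%:R * (2 * (1 - 3 * tau) * t))); last first.
    by rewrite ler_wpM2r// !mulr_ge0//; lra.
  have -> : 2 * (1 - 4 * tau) * t * N%:R = (2 * t * N%:R) * (1 - 4 * tau) by ring.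
  have -> : (1 - tau) * N%:R * (2 * (1 - 3 * tau) * t) =
    (2 * t * N%:R) * ((1 - tau) * (1 - 3 * tau)) by ring.
  by rewrite ler_wpM2l ?mulr_ge0//; nra.
have e1 : expR (- (N.-2%:R * (2 * (1 - 3 * tau) * t / N%:R))) <=
    expR (- ((1 - 4 * tau) * (2 * t))).
  by rewrite ler_expR lerN2; apply: le_trans expo; rewrite le_eqVlt; apply/orP; left;
    apply/eqP; ring.
have e2 : expR (- ((1 - 4 * tau) * (2 * t))) - expR (- (2 * t)) <=
    (1 - (1 - 4 * tau)) * (2 * t).
  by apply: expR_scale_le; rewrite ?mulr_ge0//; lra.
lra.
Qed.

End IsolationAsymptotics.

(** * Convergence in probability *)

Section SecondMoment.
Context {R : realType} (f : R -> R).
Hypothesis f_ge0 : forall x, 0 <= f x.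
Hypothesis mf : measurable_fun setT f.

Lemma measurable_count_normalized_differences d (T : measurableType d) N
    (X : 'I_N -> T -> R) (a : pred R) :
  (forall j, measurable_fun setT (X j)) -> measurable [set x | a x] ->
  measurable_fun setT
    (fun w => (count a (normalized_differences f (X^~ w)))%:R : R).
Proof.
move=> mX ma; rewrite /normalized_differences.
under eq_fun do rewrite count_map.
apply: (measurable_count _ (b := fun i w => a (normalized_difference f (X^~ w) i))).
move=> i; rewrite -[X in measurable X]setTI.
have : measurable_fun setT (fun w => normalized_difference f (X^~ w) i).
  under eq_fun do rewrite normalized_differenceE.
  apply: measurable_funM.
    apply: measurable_funM => //; apply: measurableT_comp => //.
    exact: measurable_order_stat.
  by apply: measurable_funB; exact: measurable_order_stat.
by move=> /(_ measurableT _ ma).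
Qed.

(** Chebyshev's inequality around the target [e] instead of the mean. Pairs are compared with
    [e ^ 2], which expresses asymptotic independence. There are [n.+2] points but [n.+1] gaps. *)
Lemma tail_freq_chebyshev d (T : measurableType d) (P : probability T R) n
    (X : 'I_n.+2 -> {RV P >-> R}) (t e eta delta : R) :
  0 < t -> 0 <= e <= 1 -> 0 <= eta <= 1 -> 0 < delta ->
  (forall j, e - eta <= fine (P [set w | strictly_isolated f t (X^~ w) j])) ->
  (forall j l, j != l -> fine (P [set w | weakly_isolated f t (X^~ w) j /\
                      weakly_isolated f t (X^~ w) l]) <= e ^+ 2 + eta) ->
  measurable [set w | delta < `|tail_freq (normalized_differences f (X^~ w)) t - e|] /\
  delta ^+ 2 * fine (P [set w |
    delta < `|tail_freq (normalized_differences f (X^~ w)) t - e|]) <=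
  3 * eta + 6 / n.+1%:R.
Proof.
move=> t_gt0 /andP[e_ge0 e_le1] /andP[eta_ge0 eta_le1] delta_gt0 P_strict P_weak.
pose V w : R := (count (> t)%R (normalized_differences f (X^~ w)))%:R.
have size_nd w : size (normalized_differences f (X^~ w)) = n.+1.
  by rewrite size_map size_iota.
pose Ev := [set w | delta < `|V w / n.+1%:R - e|].
have EvE : [set w | delta < `|tail_freq (normalized_differences f (X^~ w)) t - e|] = Ev.
  by apply/seteqP; split => w; rewrite /Ev /= /tail_freq size_nd.
have mV : measurable_fun setT V.
  apply: measurable_count_normalized_differences => //.
  by rewrite -[X in measurable X]/[set x | _] -set_itvoy; exact: measurable_itv.
have mEv : measurable Ev.
  rewrite -[X in measurable X]setTI.
  apply: (@measurable_fun_ltr _ _ _ setT (cst delta)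
    (fun w => `|V w / n.+1%:R - e|) _ _ measurableT [set true] I) => //.
  apply: measurableT_comp => //; apply: measurable_funB => //.
  exact: measurable_funM.
rewrite EvE; split=> //.
pose I j := [set w | strictly_isolated f t (X^~ w) j].
pose K (p : 'I_n.+2 * 'I_n.+2) := [set w | weakly_isolated f t (X^~ w) p.1 /\
   weakly_isolated f t (X^~ w) p.2].
have mI j : measurable (I j) by exact: measurable_strictly_isolated.
have mK p : measurable (K p).
  by apply: measurableI; exact: measurable_weakly_isolated.
pose N : R := n.+1%:R; have N_gt0 : 0 < N by rewrite ltr0n.
(* Apart from the event [Ev], the weights are those of [(V / N - e) ^ 2]; the additional [2 * e / N]
   on [setT] pays for the 1 lost in [strictly_isolated_le_count]. *)
pose s := (- delta ^+ 2, Ev) :: (2 * e / N + e ^+ 2, setT) ::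
  [seq (- (2 * e / N), I j) | j <- index_enum 'I_n.+2] ++
  [seq (N ^- 2, K p) | p <- index_enum _] : seq (R * set T).
have sumE (F : set T -> R) : \sum_(p <- s) p.1 * F p.2 =
    - (delta ^+ 2 * F Ev) + (2 * e / N + e ^+ 2) * F setT
    - 2 * e / N * (\sum_j F (I j)) + N ^- 2 * \sum_p F (K p).
  rewrite /s !big_cons big_cat !big_map /= mulNr -!addrA -!mulr_sumr.
  by rewrite mulNr.
have : 0 <= \sum_(p <- s) p.1 * fine (P p.2).
  apply: (@probability_combination_ge0 _ _ _ P) => [p|w].
    rewrite !in_cons !mem_cat => /orP[/eqP->//|/orP[/eqP->|]].
      exact: measurableT.
    by case/orP => /mapP[j _ ->]; [exact: mI|exact: mK].
  rewrite (sumE (fun A => \1_A w)).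
  have -> : \1_setT w = 1 :> R by rewrite indicE in_setT.
  have sI : \sum_j \1_(I j) w =
      #|[pred j | strictly_isolated f t (X^~ w) j]|%:R :> R.
    rewrite -sum1_card [in RHS]big_mkcond natr_sum; apply: eq_bigr => j _.
    rewrite indicE !inE /=; case: ifP => [iso|iso]; first by rewrite mem_set.
    by rewrite memNset// /I /= iso.
  have sK : \sum_p \1_(K p) w =
      #|[pred j | weakly_isolated f t (X^~ w) j]|%:R ^+ 2 :> R.
    rewrite -sum1_card [in RHS]big_mkcond natr_sum expr2 mulr_suml.
    under [RHS]eq_bigr do rewrite mulr_sumr.
    rewrite pair_big /=; apply: eq_bigr => -[j l] _; rewrite indicE !inE /=.
    case: ifP => [jw|jw]; last by rewrite mul0r memNset// => -[/=]; rewrite jw.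
    case: ifP => [lw|lw]; last by rewrite mulr0 memNset// => -[/= _]; rewrite lw.
    by rewrite mem_set// mulr1.
  have V_ge0 : 0 <= V w by rewrite ler0n.
  have le_V : \sum_j \1_(I j) w <= V w + 1.
    by rewrite sI natr1 ler_nat; exact: strictly_isolated_le_count.
  have V_le : V w ^+ 2 <= \sum_p \1_(K p) w.
    rewrite sK lerXn2r ?nnegrE ?ler0n// ler_nat.
    by apply: count_le_weakly_isolated => //; exact: ltW.
  have lowK : N ^- 2 * V w ^+ 2 <= N ^- 2 * \sum_p \1_(K p) w.
    by rewrite ler_pM2l// invr_gt0 exprn_gt0.
  have lowI : 2 * e / N * \sum_j \1_(I j) w <= 2 * e / N * (V w + 1).
    by rewrite ler_wpM2l// divr_ge0 ?mulr_ge0// ltW.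
  have square : N ^- 2 * V w ^+ 2 - 2 * e / N * (V w + 1) + (2 * e / N + e ^+ 2) =
      (V w / N - e) ^+ 2 by field; rewrite gt_eqF.
  have Ev_le : delta ^+ 2 * \1_Ev w <= (V w / N - e) ^+ 2.
    rewrite indicE; have [Evw|nEv] := pselect (Ev w); last first.
      by rewrite memNset// mulr0 sqr_ge0.
    rewrite mem_set// mulr1 -[leRHS]real_normK ?num_real//.
    by rewrite lerXn2r ?nnegrE ?normr_ge0 ?(ltW delta_gt0)//; exact: ltW Evw.
  rewrite mulr1; move: lowK lowI square Ev_le.
  move: (2 * e / N) (N ^- 2 * V w ^+ 2) (N ^- 2 * \sum_p _) (2 * e / N * (V w + 1))
    (2 * e / N * \sum_j _) (delta ^+ 2 * _) ((V w / N - e) ^+ 2) => *.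
  lra.
rewrite (sumE (fun A => fine (P A))) probability_setT mulr1.
have I_ge : (N + 1) * (e - eta) <= \sum_j fine (P (I j)).
  apply: (@le_trans _ _ (\sum_(j < n.+2) (e - eta))); last first.
    by apply: ler_sum => j _; exact: P_strict.
  by rewrite sumr_const card_ord -[_ *+ _]mulr_natl natr1.
(* The diagonal pairs are bounded by 1 each; there are only [N + 1] of them, so after division by
   [N ^ 2] they contribute order [1 / N]. *)
have K_le : \sum_p fine (P (K p)) <= (N + 1) * (1 + N * (e ^+ 2 + eta)).
  rewrite (eq_bigr (fun p => fine (P (K (p.1, p.2))))) => [|[j l] //].
  rewrite -(pair_big xpredT xpredT (fun j l => fine (P (K (j, l))))) /=.
  apply: (@le_trans _ _ (\sum_(j < n.+2) (1 + N * (e ^+ 2 + eta)))); last first.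
    by rewrite sumr_const card_ord -[_ *+ _]mulr_natl natr1.
  apply: ler_sum => j _; rewrite (bigD1 j)//= lerD//.
    by rewrite -lee_fin fineK ?fin_num_measure// probability_le1.
  apply: (@le_trans _ _ (\sum_(l < n.+2 | l != j) (e ^+ 2 + eta))).
    by apply: ler_sum => l lj; apply: P_weak; rewrite eq_sym.
  by rewrite sumr_const cardC1 card_ord -[_ *+ _]mulr_natl.
have e2_le1 : e ^+ 2 <= 1 by rewrite exprn_ile1.
have boundI : 2 * e / N * ((N + 1) * (e - eta)) <= 2 * e / N * \sum_j fine (P (I j)).
  by rewrite ler_wpM2l// divr_ge0 ?mulr_ge0// ltW.
have boundK : N ^- 2 * \sum_p fine (P (K p)) <=
    N ^- 2 * ((N + 1) * (1 + N * (e ^+ 2 + eta))).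
  by rewrite ler_pM2l// invr_gt0 exprn_gt0.
pose u := N^-1; have u_gt0 : 0 < u by rewrite invr_gt0.
have u_le1 : u <= 1 by rewrite invf_le1// ler1n.
(* The terms in [e ^ 2] of order 1 cancel; what remains is at most [3 * eta + 6 / N]. *)
have expand : 2 * e / N + e ^+ 2 - 2 * e / N * ((N + 1) * (e - eta)) +
    N ^- 2 * ((N + 1) * (1 + N * (e ^+ 2 + eta))) =
    (2 * e + 1) * eta + u * (2 * e - 2 * e ^+ 2 + 2 * e * eta + 1 + u + e ^+ 2 + eta).
  by rewrite /u; field; rewrite gt_eqF.
have e_eta : e * eta <= eta by rewrite ler_piMl.
have inner_le : 2 * e - 2 * e ^+ 2 + 2 * e * eta + 1 + u + e ^+ 2 + eta <= 6.
  have : 0 <= (1 - e) ^+ 2 by rewrite sqr_ge0.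
  rewrite sqrrB expr1n mul1r; lra.
have : u * (2 * e - 2 * e ^+ 2 + 2 * e * eta + 1 + u + e ^+ 2 + eta) <= u * 6.
  by rewrite ler_pM2l.
rewrite -[6 / _]/(6 * u); move: boundI boundK expand.
move: (2 * e / N) (u * (2 * e - _ + _ + _ + _ + _ + _))
  (2 * e / N * \sum_j _) (2 * e / N * ((N + 1) * (e - eta))) (N ^- 2 * \sum_p _)
  (N ^- 2 * ((N + 1) * (1 + N * (e ^+ 2 + eta)))) (delta ^+ 2 * _) => *.
lra.
Qed.

End SecondMoment.

Section DigitConvergence.
Context {R : realType} (f : R -> R) (rho : probability R R) (L M S : R).
Hypothesis f_ge0 : forall x, 0 <= f x.
Hypothesis mf : measurable_fun setT f.
Hypothesis rho_density : forall A, measurable A ->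
  rho A = (\int[lebesgue_measure]_(x in A) (f x)%:E)%E.
Hypotheses (L_ge0 : 0 <= L) (S_gt0 : 0 < S).
Hypothesis f_lip : forall x y, `|f x - f y| <= L * `|x - y|.
Hypothesis f_le : forall x, f x <= M.
Hypothesis f_supp : forall x, f x != 0 -> - S <= x < S.

Lemma tail_freq_cvg_in_probability (t delta alpha : R) :
  0 < t -> 0 < delta -> 0 < alpha ->
  exists N0 : nat, forall N, (N0 <= N)%N ->
  forall d (T : measurableType d) (P : probability T R)
    (X : 'I_N -> {RV P >-> R}), mutually_independent X ->
  (forall i A, measurable A -> P (X i @^-1` A) = rho A) ->
  measurable [set w |
    delta < `|tail_freq (normalized_differences f (X^~ w)) t - expR (- t)|] /\
  fine (P [set w |
    delta < `|tail_freq (normalized_differences f (X^~ w)) t - expR (- t)|]) <=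
  alpha.
Proof.
move=> t_gt0 delta_gt0 alpha_gt0.
have gap_gt0 : 0 < alpha * delta ^+ 2 by rewrite mulr_gt0 ?exprn_gt0.
have [eta [eta_gt0 [eta_le1 eta_le]]] :
    exists eta : R, 0 < eta /\ eta <= 1 /\ 6 * eta <= alpha * delta ^+ 2.
  exists (Num.min 1 (alpha * delta ^+ 2 / 6)); split; last split.
  - by rewrite lt_min ltr01 divr_gt0.
  - by rewrite ge_min lexx.
  - by rewrite mulrC -ler_pdivlMr// ge_min lexx orbT.
have [N1 asymp] := isolated_asymptotics f_ge0 mf rho_density L_ge0 S_gt0
  f_lip f_le f_supp t_gt0 eta_gt0.
(* Half of [alpha * delta ^+ 2] is spent on [3 * eta], half on [6 / n.+1%:R]. The threshold has
   [.+2] because [N] is [n.+2]. *)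
pose c := 12 / (alpha * delta ^+ 2).
exists (maxn (maxn N1 2) (Num.truncn c).+2) => N.
rewrite !geq_max => /andP[/andP[le_N1 le_2] le_c] d T P X X_indep X_law.
case: N X X_indep X_law le_N1 le_2 le_c => [|[|n]]// X X_indep X_law le_N1 _ le_c.
have [strict weak] := asymp _ le_N1 _ _ _ _ X_indep X_law.
have e_itv : 0 <= expR (- t) <= 1.
  by rewrite expR_ge0 -expR0 ler_expR oppr_le0 ltW.
have eta_itv : 0 <= eta <= 1 by rewrite ltW.
have weak' j l (jl : j != l) : fine (P [set w | weakly_isolated f t (X^~ w) j /\
    weakly_isolated f t (X^~ w) l]) <= expR (- t) ^+ 2 + eta.
  rewrite -expRM_natl mulrN; exact: weak.
have [mE le_E] := tail_freq_chebyshev f_ge0 mf t_gt0 e_itv eta_itv delta_gt0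
  strict weak'.
split=> //; rewrite -(@ler_pM2l _ (delta ^+ 2)) ?exprn_gt0//.
apply: (le_trans le_E); rewrite [leRHS]mulrC.
have c_lt : c < n.+1%:R.
  by apply: (lt_le_trans (truncnS_gt c)); rewrite ler_nat.
have : 6 / n.+1%:R <= alpha * delta ^+ 2 / 2.
  rewrite ler_pdivrMr// mulrAC ler_pdivlMr//.
  by move: c_lt; rewrite /c ltr_pdivrMr// [_ * (alpha * _)]mulrC => /ltW; lra.
move: eta_le; move: (alpha * delta ^+ 2) (6 / n.+1%:R) => *; lra.
Qed.

(** A digit frequency that is off forces one of finitely many tail frequencies to be off, and a
    union bound concludes. *)
Lemma digit_freq_cvg_in_probability (B a b delta alpha : R) :
  1 < B -> 1 <= a -> a <= b -> b <= B -> 0 < delta -> 0 < alpha ->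
  exists N0 : nat, forall N, (N0 <= N)%N ->
  forall d (T : measurableType d) (P : probability T R)
    (X : 'I_N -> {RV P >-> R}), mutually_independent X ->
  (forall i A, measurable A -> P (X i @^-1` A) = rho A) ->
  measurable [set w | delta < `|digit_freq B (normalized_differences f (X^~ w)) a b
    - exponential_digit_law B a b|] /\
  fine (P [set w | delta < `|digit_freq B (normalized_differences f (X^~ w)) a b
    - exponential_digit_law B a b|]) <= alpha.
Proof.
move=> B_gt1 a_ge1 ab bB delta_gt0 alpha_gt0.
have [ts ts_gt0 [delta' delta'_gt0 approx]] :=
  digit_freq_approx B_gt1 a_ge1 ab bB delta_gt0.
pose alpha' := alpha / (size ts).+1%:R.
have alpha'_gt0 : 0 < alpha' by rewrite divr_gt0.
have [N1 tail] : exists N1 : nat, forall t, t \in ts -> forall N, (N1 <= N)%N ->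
  forall d (T : measurableType d) (P : probability T R)
    (X : 'I_N -> {RV P >-> R}), mutually_independent X ->
  (forall i A, measurable A -> P (X i @^-1` A) = rho A) ->
  measurable [set w |
    delta' < `|tail_freq (normalized_differences f (X^~ w)) t - expR (- t)|] /\
  fine (P [set w |
    delta' < `|tail_freq (normalized_differences f (X^~ w)) t - expR (- t)|]) <=
  alpha'.
  elim: ts ts_gt0 {approx alpha'_gt0} alpha' (alpha'_gt0) => [|t ts IH] ts_gt0 al al_gt0.
    by exists 0%N.
  have [|N1 H1] := IH _ al al_gt0.
    by move=> u uts; apply: ts_gt0; rewrite inE uts orbT.
  have [N2 H2] := tail_freq_cvg_in_probability (ts_gt0 t (mem_head _ _))
    delta'_gt0 al_gt0.
  exists (maxn N1 N2) => u + N; rewrite geq_max inE => uts /andP[le1 le2].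
  by case/orP: uts => [/eqP->|uts]; [exact: H2|exact: H1].
(* At least two points are needed for the list of gaps to be nonempty, as [approx] requires. *)
exists (maxn N1 2) => N; rewrite geq_max => /andP[le_N1 le_2] d T P X X_indep X_law.
pose Ev := [set w | delta < `|digit_freq B (normalized_differences f (X^~ w)) a b
    - exponential_digit_law B a b|].
pose Et t := [set w |
    delta' < `|tail_freq (normalized_differences f (X^~ w)) t - expR (- t)|].
have mEt t : t \in ts -> measurable (Et t).
  by move=> /tail/(_ _ le_N1 _ _ _ _ X_indep X_law)[].
have size_nd w : size (normalized_differences f (X^~ w)) = N.-1.
  by rewrite size_map size_iota.
have mEv : measurable Ev.
  rewrite -[X in measurable X]setTI.
  apply: (@measurable_fun_ltr _ _ _ setT (cst delta)
    (fun w => `|digit_freq B (normalized_differences f (X^~ w)) a b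
    - exponential_digit_law B a b|) _ _ measurableT [set true] I) => //.
  apply: measurableT_comp => //; apply: measurable_funB => //.
  rewrite /digit_freq; under eq_fun do rewrite size_nd.
  apply: measurable_funM => //.
  apply: measurable_count_normalized_differences => //.
  exact: measurable_digit_set.
split=> //.
pose s := (-1, Ev) :: [seq (1, Et t) | t <- ts] : seq (R * set T).
have sumE (F : set T -> R) : \sum_(p <- s) p.1 * F p.2 = - F Ev + \sum_(t <- ts) F (Et t).
  by rewrite /s big_cons big_map mulN1r; congr (_ + _); apply: eq_bigr => t _; rewrite mul1r.
have : 0 <= \sum_(p <- s) p.1 * fine (P p.2).
  apply: (@probability_combination_ge0 _ _ _ P) => [p|w].
    by rewrite in_cons => /orP[/eqP->//|/mapP[t tts ->]]; exact: mEt.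
  rewrite (sumE (fun A => \1_A w)).
  have S_ge0 (r : seq R) : 0 <= \sum_(t <- r) \1_(Et t) w :> R.
    by apply: sumr_ge0 => t _; rewrite indicE.
  have [Evw|nEv] := pselect (Ev w); last by rewrite indicE memNset// oppr0 add0r.
  have [t tts Etw] : exists2 t, t \in ts & Et t w.
    apply: contrapT => no_t; move: Evw; rewrite /Ev /= ltNge => /negP; apply.
    apply: approx => [|t tts]; first by rewrite size_nd ltn_predRL.
    by rewrite leNgt; apply/negP => Etw; apply: no_t; exists t.
  rewrite [\1_Ev w]indicE mem_set// addrC subr_ge0 (big_rem t)//= [\1_(Et t) w]indicE.
  by rewrite mem_set// lerDl.
rewrite (sumE (fun A => fine (P A))) addrC subr_ge0 => /le_trans; apply.
apply: (@le_trans _ _ (\sum_(t <- ts) alpha')).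
  rewrite big_seq [leRHS]big_seq; apply: ler_sum => t tts.
  by have [] := tail t tts _ le_N1 _ _ _ _ X_indep X_law.
rewrite big_const_seq count_predT iter_addr_0 -mulr_natl /alpha' mulrCA.
by rewrite ler_piMr ?(ltW alpha_gt0)// ler_pdivrMr// mul1r ler_nat.
Qed.

End DigitConvergence.

(** * Lipschitz bound, measurability and bounded support of the density *)

Section DensityRegularity.
Context {R : realType} (f : R -> R).
Hypothesis f_derivable : forall x, derivable f x 1.

Lemma bounded_derive1_lipschitz L : (forall x, `|derive1 f x| <= L) ->
  forall x y, `|f x - f y| <= L * `|x - y|.
Proof.
move=> f'_le x y; wlog xy : x y / y <= x.
  move=> le_lip; have /orP[yx|xy] := le_total y x; first exact: le_lip.
  by rewrite distrC (distrC x) le_lip.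
have der z : z \in `]y, x[ -> is_derive z 1 f (derive1 f z).
  by move=> _; rewrite derive1E; exact/derivableP.
have cont : {within `[y, x], continuous f}.
  apply: continuous_subspaceT => z.
  exact/differentiable_continuous/derivable1_diffP.
have [c _ ->] := MVT_segment xy der cont.
by rewrite normrM ler_wpM2r.
Qed.

Lemma derivable_measurable_fun : measurable_fun setT f.
Proof.
apply: continuous_measurable_fun => z.
exact/differentiable_continuous/derivable1_diffP.
Qed.

Lemma compactly_supported_bound : compactly_supported f ->
  exists2 S, 0 < S & forall x, f x != 0 -> - S <= x < S.
Proof.
move=> /compact_bounded[M [_ M_bound]]; exists (`|M| + 2).
  by rewrite ltr_wpDl.
move=> x fx; have : `|x| <= `|M| + 1.
  apply: M_bound; first by rewrite (le_lt_trans (ler_norm M))// ltrDl.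
  exact: subset_closure.
by rewrite ler_norml => /andP[? ?]; apply/andP; split; lra.
Qed.

End DensityRegularity.

Theorem theorem1p7 (R : realType) (B delta eps : R) (f : R -> R)
    (d : nat -> measure_display) (T : forall N, measurableType (d N))
    (P : forall N, probability (T N) R)
    (X : forall N, 'I_N -> {RV (P N) >-> R})
    (hB : 1 < B) (hdelta : 0 < delta < 1)
    (f_ge0 : forall x, 0 <= f x)
    (f_supp : compactly_supported f)
    (f_taylor : forall x, second_order_taylor_at f x)
    (f_bounded' : uniformly_bounded (derive1 f))
    (f_bounded'' : uniformly_bounded (derive1 (derive1 f)))
    (X_indep : forall N, mutually_independent (X N))
    (X_density : forall N (i : 'I_N), has_density (X N i) f)
    (heps : 0 < eps < 1 / 2)
    (hi : density_not_too_small f delta eps)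
    (hii : log_density_equidistributed f B delta eps)
    (heps_gt : Num.max 0 (1 / 3 - delta / 2) < eps)
    (heps_lt : eps < delta / 2) :
  converges_to_shifted_exponential_behavior B P
    (fun N (w : T N) => normalized_differences f (fun i => X N i w)).
Proof.
have f_derivable x : derivable f x 1 by case: (f_taylor x).
have mf : measurable_fun setT f := derivable_measurable_fun f_derivable.
have [L f'_le] := f_bounded'.
have f_lip := bounded_derive1_lipschitz f_derivable f'_le.
have L_ge0 : 0 <= L by exact: le_trans (f'_le 0).
have [S S_gt0 f_S] := compactly_supported_bound f_supp.
(* The density vanishes at [S], the excluded right end, so the Lipschitz bound across the support
   also bounds [f]. *)
have f_le x : f x <= L * (2 * S).
  have [->|fx] := eqVneq (f x) 0; first by rewrite !mulr_ge0// ltW.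
  have fS : f S = 0.
    by apply/eqP; apply: contraT => /f_S; rewrite ltxx andbF.
  have /andP[xS Sx] := f_S x fx.
  apply: le_trans (ler_norm _) _; rewrite -[f x]subr0 -fS.
  apply: (le_trans (f_lip _ _)); rewrite ler_wpM2l// ltr0_norm ?subr_lt0//; lra.
(* All the variables have density [f], hence the same law; it is read off the sample of size 1. *)
pose rho : probability R R := distribution (P 1%N) (X 1%N ord0).
have rho_density A : measurable A ->
    rho A = (\int[lebesgue_measure]_(x in A) (f x)%:E)%E.
  exact: X_density.
have X_law N i A : measurable A -> P N (X N i @^-1` A) = rho A.
  by move=> mA; rewrite rho_density//; exact: X_density.
exists 1 => // a b a_ge1 ab bB eta eta_gt0.
have small := digit_freq_cvg_in_probability f_ge0 mf rho_density L_ge0 S_gt0 f_lip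
  f_le f_S hB a_ge1 ab bB eta_gt0.
have scale1 (r : seq R) : [seq 1 * z | z <- r] = r.
  by rewrite (eq_map (@mul1r R)) map_id.
under eq_fun do under eq_set do rewrite scale1.
apply/fine_cvgP; split.
  (* Only measurability is taken from this instance; the bound 1 is arbitrary. *)
  have [N0 small0] := small 1 ltr01; exists N0 => // N /= le_N.
  by rewrite fin_num_measure//; have [] := small0 N le_N _ _ _ _ (X_indep N) (X_law N).
apply/cvgrPdist_le => e e_gt0; have [N0 small0] := small e e_gt0.
exists N0 => // N /= le_N; rewrite sub0r normrN ger0_norm ?fine_ge0//.
by have [] := small0 N le_N _ _ _ _ (X_indep N) (X_law N).
Qed.
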